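(* Let $\{E_n : n\ge 0\}$ be a list of pairwise non-homeomorphic non-trivial planar continua $E_n\subset[\frac14,\frac34]^2\times\{\frac12\}$, and for each $n\ge 0$ let $D_n\subset E_n$ be an enumerated countable dense subset. Let $\mathcal{E}^{(1)}=\{(E_f,D_f) : f\in\mathbb{N}^{<\mathbb{N}}\}$ be the list with $E_f=E_n$ and $D_f=D_n$ whenever $f\in\mathbb{N}^n$ (so $E_f$ depends only on the length of $f$). Then the space $X_{\mathcal{E}^{(1)}}$ is a non-reconstructible compact metrizable space without a constant universal sequence.
   Context: Conventions: $\mathbb{N}=\{1,2,\dots\}$; $\mathbb{N}^{<\mathbb{N}}$ is the set of finite sequences in $\mathbb{N}$, including the empty sequence $\emptyset$; $\mathbb{N}^n$ is the set of those of length $n$; $f^\frown k$ is $f$ extended by $k$; $I=[0,1]$. A continuum is a compact connected metrizable space; it is non-trivial if it has more than one point. $d_\infty$ is the sup-metric on $\mathbb{R}^3$ and $\overline{B}^\infty_r(c)=\{x\in\mathbb{R}^3 : d_\infty(x,c)\le r\}$. Relativization: for a cube $Q=\overline{B}^\infty_r(c)$ let $a_Q:I^3\to Q$, $a_Q(x)=2r\left(x-(\tfrac12,\tfrac12,\tfrac12)\right)+c$; for $A\subseteq I^3$ write $A|Q=a_Q(A)$. Building block: for a non-trivial continuum $E\subset[\frac14,\frac34]^2\times\{\frac12\}\subset I^3$ and a countable dense enumerated $D=\{d_k : k\in\mathbb{N}\}\subset E$, put $F_k^{E,D}=\overline{B}^\infty_{2^{-2k-1}}\left(d_k+(0,0,2^{-2k})\right)$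 and $C_{E,D}=E\cup\bigcup_{k\in\mathbb{N}}F_k^{E,D}\subset I^3$. Construction of $X_{\mathcal{E}}$: given a list $\mathcal{E}=\{(E_f,D_f) : f\in\mathbb{N}^{<\mathbb{N}}\}$ of non-trivial continua $E_f\subset[\frac14,\frac34]^2\times\{\frac12\}$ with enumerated countable dense subsets $D_f\subset E_f$, let $X_1=C_{E_\emptyset,D_\emptyset}$ and $F_{\langle k\rangle}=F_k^{E_\emptyset,D_\emptyset}$ for $k\in\mathbb{N}$. Given $X_n$ and cubes $F_f$ for $f\in\mathbb{N}^n$, let $X_{n+1}=\left(X_n\setminus\bigcup_{f\in\mathbb{N}^n}F_f\right)\cup\bigcup_{f\in\mathbb{N}^n}\left(C_{E_f,D_f}|F_f\right)$ and $F_{f^\frown k}=F_k^{E_f,D_f}|F_f$ for $f\in\mathbb{N}^n$, $k\in\mathbb{N}$. Finally $X_{\mathcal{E}}=\bigcap_n X_n$. A sequence $\langle B_n\rangle$ of subsets of $X$ converges to $x$ if every neighbourhood of $x$ contains $B_n$ for all sufficiently large $n$. $X$ has a constant universal sequence if there is a non-empty space $T$ such that every point of $X$ is the limit of a sequence of pairwise disjoint clopen subsets of $X$, each homeomorphic to $T$. The deck of $X$ is $\mathcal{D}(X)=\{[X\setminus\{x\}] : x\in X\}$, where $[Y]$ is the homeomorphism class of $Y$. $X$ is reconstructible if every topological space $Z$ with $\mathcal{D}(Z)=\mathcal{D}(X)$ is homeomorphic to $X$; non-reconstructible otherwise. *)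

(* Defs.v *)
From HB Require Import structures.
From mathcomp Require Import all_boot all_order all_algebra.
From mathcomp Require Import all_classical all_reals all_analysis.
Set Implicit Arguments.
Unset Strict Implicit.
Unset Printing Implicit Defensive.
Import Order.TTheory GRing.Theory Num.Theory.
Import numFieldTopology.Exports numFieldNormedType.Exports.
Local Open Scope classical_set_scope.
Local Open Scope ring_scope.

(* A subset [A] of a topological space is regarded as a space in its own right
   through the coercion [set_type], which carries the subspace topology. *)

Definition homeomorphic (S T : topologicalType) : Prop :=
  exists (f : S -> T) (g : T -> S),
    [/\ continuous f, continuous g, cancel f g & cancel g f].

Definition homeo_class (Y : topologicalType) : topologicalType -> Prop :=
  fun W => homeomorphic W Y.

(* Predicates rather than [set]s, whose universe is too small for
   [topologicalType]. *)
Definition deck (X : topologicalType) : (topologicalType -> Prop) -> Prop :=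
  fun C => exists x : X, C = homeo_class (~` [set x]).

Definition reconstructible (X : topologicalType) : Prop :=
  forall Z : topologicalType, deck Z = deck X -> homeomorphic Z X.

Definition metrizable (R : realType) (T : topologicalType) : Prop :=
  exists M : metricType R, homeomorphic T M.

Definition constant_universal_sequence (X : topologicalType) : Prop :=
  exists2 T : topologicalType, [set: T] !=set0 &
    forall x : X, exists B : nat -> set X,
      [/\ trivIset [set: nat] B,
          forall n, clopen (B n),
          forall n, homeomorphic (B n) T &
          forall U, nbhs x U -> \forall n \near \oo, B n `<=` U].

Definition continuum (R : realType) (T : topologicalType) : Prop :=
  [/\ compact [set: T], connected [set: T] & metrizable R T].

Definition nontrivial (T : Type) : Prop := exists x y : T, x <> y.

Section construction.
Variable R : realType.
Notation R3 := 'rV[R]_3.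

Definition vec3 (a b c : R) : R3 := \row_(j < 3) [:: a; b; c]`_j.

(* [1/4, 3/4]^2 x {1/2} *)
Definition middle_square : set R3 :=
  [set vec3 a b 2^-1 | a in `[4^-1, 3 / 4] & b in `[4^-1, 3 / 4]].

(* A cube is given by its centre and radius; the norm of 'rV[R]_3 is the
   sup-norm. *)
Record cube := Cube { cube_centre : R3; cube_radius : R }.

Definition cube_set (Q : cube) : set R3 :=
  closed_ball_ Num.norm (cube_centre Q) (cube_radius Q).

Definition mid : R3 := vec3 2^-1 2^-1 2^-1.

(* I^3 *)
Definition unit_cube : cube := Cube mid 2^-1.

(* the map a_Q, extended to the whole of R^3 *)
Definition cube_map (Q : cube) (x : R3) : R3 :=
  (2 * cube_radius Q) *: (x - mid) + cube_centre Q.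

(* A | Q *)
Definition relativize (A : set R3) (Q : cube) : set R3 := cube_map Q @` A.

(* P | Q, as a cube; see [cube_set_relativize]. *)
Definition relativize_cube (P Q : cube) : cube :=
  Cube (cube_map Q (cube_centre P)) (2 * cube_radius Q * cube_radius P).

(* Indices are shifted: the natural number [k] stands for the positive integer
   k + 1, so [d k] is d_(k+1) and [block_cube d k] is F_(k+1), of radius
   2^(-2(k+1)-1) and at height 2^(-2(k+1)) above d_(k+1). *)
Definition block_cube (d : nat -> R3) (k : nat) : cube :=
  Cube (d k + vec3 0 0 (2 ^- (2 * k.+1))) (2 ^- (2 * k.+1 + 1)).

(* C_{E,D} *)
Definition block (E : set R3) (d : nat -> R3) : set R3 :=
  E `|` \bigcup_k cube_set (block_cube d k).

Section family.
Variables (E : seq nat -> set R3) (d : seq nat -> nat -> R3).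

(* [cube_from p Q f] is the cube reached from the cube [Q], sitting at the
   sequence [p], by following the indices in [f]. *)
Fixpoint cube_from (p : seq nat) (Q : cube) (f : seq nat) : cube :=
  if f is k :: f' then
    cube_from (rcons p k) (relativize_cube (block_cube (d p) k) Q) f'
  else Q.

(* F_f, with F_f = I^3 for the empty sequence; see [cube_at_rcons] and
   [cube_at1]. *)
Definition cube_at (f : seq nat) : cube := cube_from [::] unit_cube f.

(* [stage n] is X_(n+1). *)
Fixpoint stage (n : nat) : set R3 :=
  if n is n'.+1 then
    (stage n' `\` \bigcup_(f in [set f | size f = n]) cube_set (cube_at f))
    `|` \bigcup_(f in [set f | size f = n])
          relativize (block (E f) (d f)) (cube_at f)
  else block (E [::]) (d [::]).

Definition limit_space : set R3 := \bigcap_n stage n.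

End family.

(* [d] enumerates, possibly with repetitions, a dense subset of [E]. *)
Definition dense_enumeration (E : set R3) (d : nat -> R3) : Prop :=
  range d `<=` E /\ E `<=` closure (range d).

Lemma cube_set_relativize P Q : 0 < cube_radius Q ->
  cube_set (relativize_cube P Q) = relativize (cube_set P) Q.
Proof.
move=> r0; have r2 : 0 < 2 * cube_radius Q by rewrite mulr_gt0.
have key x : cube_set (relativize_cube P Q) (cube_map Q x) = cube_set P x.
  rewrite /cube_set /closed_ball_ /= /cube_map opprD addrACA subrr addr0.
  by rewrite -scalerBr opprB addrA subrK normrZ gtr0_norm// ler_pM2l.
apply/seteqP; split => [y yQ|_ [x xP <-]]; last by rewrite key.
exists ((2 * cube_radius Q)^-1 *: (y - cube_centre Q) + mid); last first.
  by rewrite /cube_map addrK scalerA mulfV ?gt_eqF// scale1r subrK.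
by rewrite -key /cube_map addrK scalerA mulfV ?gt_eqF// scale1r subrK.
Qed.

Lemma cube_at_rcons d f k :
  cube_at d (rcons f k) = relativize_cube (block_cube (d f) k) (cube_at d f).
Proof.
have cube_from_rcons p Q : cube_from d p Q (rcons f k) =
    relativize_cube (block_cube (d (p ++ f)) k) (cube_from d p Q f).
  elim: f p Q => [|j f IH] p Q /=; first by rewrite cats0.
  by rewrite IH cat_rcons.
exact: cube_from_rcons [::] unit_cube.
Qed.

Lemma cube_at1 d k : cube_at d [:: k] = block_cube (d [::]) k.
Proof.
rewrite /cube_at /= /relativize_cube /cube_map /=.
by rewrite mulfV ?pnatr_eq0// scale1r mul1r subrK.
Qed.

End construction.

(* Main.v *)
Require Import Defs.
From HB Require Import structures.
From mathcomp Require Import all_boot all_order all_algebra.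
From mathcomp Require Import all_classical all_reals all_analysis.
From mathcomp Require Import ring lra.
Import Order.TTheory GRing.Theory Num.Theory.
Import numFieldTopology.Exports numFieldNormedType.Exports.
Local Open Scope classical_set_scope.
Local Open Scope ring_scope.
Set Implicit Arguments.
Unset Strict Implicit.
Unset Printing Implicit Defensive.

(** For a finite sequence f write P_f, or [piece f], for the part of the
    limit space X inside the cube F_f, or [node f], and C_f, or [core f],
    for the copy of E_f that the construction puts into F_f. Each P_f is
    clopen in X, and the pieces inside P_f accumulate at every point of C_f,
    because E_f has no isolated points and D_f is dense in it. As E_f
    depends only on the length of f, the similarity that carries F_f to F_g
    carries P_f to P_g whenever f and g have the same length
    ([subhomeo_piece]).

    A connected subset of X with two points lies in a single C_f
    ([connected_in_core]). This excludes a constant universal sequence: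
    every neighbourhood of a point contains some piece, hence some C_h, so T
    would be a clopen part of X containing some C_h; near a point that lies
    in infinitely many cubes, T would also be a clopen part of a piece P_f
    with f longer than h. The homeomorphism between the two copies sends C_h
    onto another C_k with k at least as long as f, against the assumption
    that the continua are pairwise not homeomorphic ([clopen_part_level]).

    For the failure of reconstruction, let x lie in cubes F_f of every
    length of f. Then X \ {x} is not compact, so it is not homeomorphic to
    X, but it has the same deck, because X \ {x, y} is homeomorphic to X \
    {y} for every other point y ([subhomeo_limit_spaceD]). The reason is an
    absorption: if g properly extends f then P_f \ P_g is homeomorphic to
    P_f, since infinitely many copies of P_g converge to a point of C_f and
    can be shifted into the hole ([subhomeo_pieceD]). Consequently each
    layer between two consecutive cubes around x is homeomorphic to a whole
    piece. Now choose disjoint pieces converging to the missing point y, and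
    inside each of them a smaller piece, indexed by sequences of the same
    lengths as the layers around x. Each large piece absorbs its small
    piece, so the small pieces are free to take the place of the layers;
    since everything that moves accumulates only at the missing points x and
    y, the pieces of this map glue to a homeomorphism. *)

(** * Homeomorphisms between subsets *)

(** Total functions on the ambient spaces, of which only the values on [A] and
    [B] matter, avoid subtypes when homeomorphisms are restricted and glued. A
    homeomorphism is a pair of maps each of which embeds and is undone by the
    other, so most proofs treat one direction and conclude by symmetry. *)
Definition embeds (S T : topologicalType) (A : set S) (B : set T)
    (f : S -> T) (g : T -> S) : Prop :=
  [/\ {homo f : x / A x >-> B x}, forall x, A x -> g (f x) = x &
      {within A, continuous f}].

Definition subhomeo (S T : topologicalType) (A : set S) (B : set T) : Prop :=
  exists (f : S -> T) (g : T -> S), embeds A B f g /\ embeds B A g f.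

Lemma within_contP (S T : topologicalType) (A : set S) (f : S -> T) :
  {within A, continuous f} <->
  forall x, A x -> forall U, nbhs (f x) U -> nbhs x [set y | A y -> U (f y)].
Proof. exact: subspace_continuousP. Qed.

Lemma homeomorphic_refl (S : topologicalType) : homeomorphic S S.
Proof. by exists id, id; split => // x; exact: cvg_id. Qed.

Lemma homeomorphic_sym (S T : topologicalType) :
  homeomorphic S T -> homeomorphic T S.
Proof. by move=> [f [g [? ? ? ?]]]; exists g, f; split. Qed.

Lemma homeomorphic_trans (S T U : topologicalType) :
  homeomorphic S T -> homeomorphic T U -> homeomorphic S U.
Proof.
move=> [f [g [cf cg fK gK]]] [f' [g' [cf' cg' fK' gK']]].
exists (f' \o f), (g \o g'); split; [| |exact: can_comp|exact: can_comp].
- by move=> x; apply: continuous_comp; [exact: cf|exact: cf'].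
- by move=> x; apply: continuous_comp; [exact: cg'|exact: cg].
Qed.

Lemma subhomeo_refl (S : topologicalType) (A : set S) : subhomeo A A.
Proof.
have emb : embeds A A id id.
  split=> //; apply/within_contP => x _ U /=; apply: filterS => y Uy _.
  exact: Uy.
by exists id, id.
Qed.

Lemma subhomeo_sym (S T : topologicalType) (A : set S) (B : set T) :
  subhomeo A B -> subhomeo B A.
Proof. by move=> [f [g [? ?]]]; exists g, f. Qed.

Lemma embeds_comp (S T U : topologicalType) (A : set S) (B : set T) (C : set U)
    f g f' g' :
  embeds A B f g -> embeds B C f' g' -> embeds A C (f' \o f) (g \o g').
Proof.
move=> [AB fK /within_contP cf] [BC fK' /within_contP cf']; split.
- by move=> x /AB /BC.
- by move=> x Ax /=; rewrite fK' ?fK//; exact: AB.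
- apply/within_contP => x Ax W /(cf' _ (AB _ Ax)) /(cf _ Ax).
  by apply: filterS => y /= h Ay; apply: h => //; exact: AB.
Qed.

Lemma subhomeo_trans (S T U : topologicalType) (A : set S) (B : set T)
    (C : set U) :
  subhomeo A B -> subhomeo B C -> subhomeo A C.
Proof.
move=> [f [g [fg gf]]] [f' [g' [fg' gf']]].
by exists (f' \o f), (g \o g'); split; [exact: embeds_comp fg'|exact: embeds_comp gf].
Qed.

Lemma subhomeo_homeomorphic (S T : topologicalType) (A : set S) (B : set T) :
  subhomeo A B -> homeomorphic A B.
Proof.
have key (S' T' : topologicalType) (A' : set S') (B' : set T') f g :
    embeds A' B' f g ->
    exists F : A' -> B', continuous F /\ forall x, set_val (F x) = f (set_val x).
  move=> [AB _ cf].
  have FB (x : A') : f (set_val x) \in B' by apply/mem_set/AB/set_mem/(valP x).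
  exists (fun x => exist _ (f (set_val x)) (FB x)); split => //.
  apply: (@continuous_comp_initial _ _ _ set_val).
  exact/subspace_sigL_continuousP.
move=> [f [g [fg gf]]].
have [[F [cF FE]] [G [cG GE]]] := (key _ _ _ _ _ _ fg, key _ _ _ _ _ _ gf).
exists F, G; split => // x; apply: val_inj; rewrite -!set_valE.
- by rewrite GE FE; case: fg => _ -> //; exact/set_mem/(valP x).
- by rewrite FE GE; case: gf => _ -> //; exact/set_mem/(valP x).
Qed.

Lemma homeomorphic_subhomeo (S T : topologicalType) (s0 : S) (t0 : T)
    (A : set S) (B : set T) :
  homeomorphic A B -> subhomeo A B.
Proof.
move=> [F [G [cF cG FK GK]]].
exists (valL_ t0 (set_val \o F)), (valL_ s0 (set_val \o G)).
have FE (x : A) : valL_ t0 (set_val \o F) (set_val x) = set_val (F x).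
  by rewrite -[LHS]/(sigL A (valL_ t0 (set_val \o F)) x) valLK.
have GE (x : B) : valL_ s0 (set_val \o G) (set_val x) = set_val (G x).
  by rewrite -[LHS]/(sigL B (valL_ s0 (set_val \o G)) x) valLK.
split; split.
- move=> x /mem_set Ax; rewrite -[x]/(set_val (exist _ x Ax : A)) FE.
  exact: set_valP.
- move=> x /mem_set Ax; rewrite -[x]/(set_val (exist _ x Ax : A)) FE.
  by rewrite GE FK.
- apply/subspace_valL_continuousP' => x; apply: continuous_comp; first exact: cF.
  exact: initial_continuous.
- move=> x /mem_set Ax; rewrite -[x]/(set_val (exist _ x Ax : B)) GE.
  exact: set_valP.
- move=> x /mem_set Ax; rewrite -[x]/(set_val (exist _ x Ax : B)) GE.
  by rewrite FE GK.
- apply/subspace_valL_continuousP' => x; apply: continuous_comp; first exact: cG.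
  exact: initial_continuous.
Qed.

(** Removing a point from a subspace, or taking a clopen subset of it, yields a
    subspace of a subspace; this brings it back to the ambient space. *)
Lemma homeomorphic_set_val (S : topologicalType) (A : set S) (B : set A) :
  homeomorphic B (set_val @` B).
Proof.
have sB (x : B) : set_val (set_val x) \in set_val @` B.
  by apply/mem_set; exists (set_val x) => //; exact: set_valP.
have sA (y : set_val @` B) : set_val y \in A.
  by have /set_mem[a _ ay] := valP y; rewrite set_valE/= -ay; apply/mem_set/set_valP.
have sAB (y : set_val @` B) : exist _ (set_val y) (sA y) \in B.
  apply/mem_set; have /set_mem[a Ba ay] := valP y.
  by rewrite (_ : exist _ _ _ = a)//; apply: val_inj; rewrite /= set_valE -ay.
pose F (x : B) : set_val @` B := exist _ (set_val (set_val x)) (sB x).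
pose G (y : set_val @` B) : B := exist _ (exist _ (set_val y) (sA y)) (sAB y).
exists F, G; split.
- apply: (@continuous_comp_initial _ _ _ set_val) => x.
  by apply: (@continuous_comp _ _ _ set_val set_val); exact: initial_continuous.
- apply: (@continuous_comp_initial _ _ _ set_val).
  apply: (@continuous_comp_initial _ _ _ set_val).
  exact: initial_continuous.
- by move=> x; do 2 apply: val_inj.
- by move=> x; apply: val_inj.
Qed.

(** * Subsets as spaces *)

Lemma compact_set_type (S : topologicalType) (A : set S) :
  compact [set: A] <-> compact A.
Proof.
split=> [cA|cA F FF _].
  have -> : A = set_val @` [set: A].
    apply/seteqP; split=> [x Ax|_ [x _ <-]]; last exact: set_valP.
    by exists (exist _ x (mem_set Ax)).
  apply: continuous_compact => //; apply: continuous_subspaceT.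
  exact: initial_continuous.
have [|p [Ap pF]] := cA (set_val @ F) _.
  by apply: (@filterS _ F _ setT) => [x _|]; [exact: set_valP|exact: filterT].
exists (exist _ p (mem_set Ap)); split=> // U V FU [W [[Q oQ <-] Qp] QV].
have FU' : (set_val @ F) (set_val @` U).
  by apply: (@filterS _ F _ U) => // x Ux; exists x.
have [_ [[x Ux <-] Qx]] := pF _ _ FU' (open_nbhs_nbhs (conj oQ Qp)).
by exists x; split=> //; exact: QV.
Qed.

Lemma connected_set_type (S : topologicalType) (A : set S) :
  connected [set: A] -> connected A.
Proof.
move=> cA; have -> : A = set_val @` [set: A].
  apply/seteqP; split=> [x Ax|_ [x _ <-]]; last exact: set_valP.
  by exists (exist _ x (mem_set Ax)).
apply: connected_continuous_connected => //; apply: continuous_subspaceT.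
exact: initial_continuous.
Qed.

Section set_type_metric.
Variables (R : realType) (V : normedModType R) (A : set V).

Let dist (x y : A) : R := `|set_val x - set_val y|.

Let dist_ge0 x y : 0 <= dist x y. Proof. exact: normr_ge0. Qed.

Let dist_positivity x y : dist x y = 0 -> x = y.
Proof. by move=> /normr0_eq0/eqP; rewrite subr_eq0 => /eqP/val_inj. Qed.

Let ballEdist x e : ball x e = [set y | dist x y < e].
Proof.
apply/funext => y; rewrite /ball/= /initial_ball/= -ball_normE.
by [].
Qed.

HB.instance Definition _ :=
  PseudoMetric_isMetric.Build R A dist_ge0 dist_positivity ballEdist.

Lemma metrizable_subset : metrizable R A.
Proof. by exists A; exact: homeomorphic_refl. Qed.

End set_type_metric.

Lemma homeo_class_eq (Y W : topologicalType) :
  homeomorphic Y W -> homeo_class Y = homeo_class W.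
Proof.
move=> YW; apply/funext => Z; apply/propext; split=> ZY.
- exact: homeomorphic_trans YW.
- exact: homeomorphic_trans (homeomorphic_sym YW).
Qed.

(** The cards of a subspace, computed in the ambient space. *)
Lemma deck_subset (S : topologicalType) (A : set S) C :
  deck A C <-> exists2 a, A a & C = homeo_class (A `\ a).
Proof.
have cardE (a : A) : homeo_class (~` [set a]) = homeo_class (A `\ set_val a).
  apply: homeo_class_eq; apply: homeomorphic_trans (homeomorphic_set_val _) _.
  rewrite (_ : set_val @` _ = A `\ set_val a); first exact: homeomorphic_refl.
  apply/seteqP; split=> [_ [x xa <-]|x [Ax xa]].
    by split; [exact: set_valP|move=> /val_inj].
  exists (exist _ x (mem_set Ax)) => // xE; apply: xa.
  by rewrite -xE.
split=> [[a ->]|[a Aa ->]]; first by exists (set_val a); [exact: set_valP|].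
by exists (exist _ a (mem_set Aa)); rewrite cardE.
Qed.

(** * Gluing homeomorphisms *)

(** Continuity is local, and each [A i] is a neighbourhood of its points
    relative to the union, so that homeomorphisms of the parts glue without any
    condition that relates them. *)
Lemma subhomeo_bigcup (S T : topologicalType) (I : Type) (i0 : I)
    (A : I -> set S) (B : I -> set T) :
  trivIset [set: I] A -> trivIset [set: I] B ->
  (forall i x, A i x -> nbhs x [set y | (\bigcup_j A j) y -> A i y]) ->
  (forall i x, B i x -> nbhs x [set y | (\bigcup_j B j) y -> B i y]) ->
  (forall i, subhomeo (A i) (B i)) ->
  subhomeo (\bigcup_i A i) (\bigcup_i B i).
Proof.
move=> tA tB oA oB AB.
have index (U : topologicalType) (C : I -> set U) :
    exists c : U -> I, forall x, (\bigcup_i C i) x -> C (c x) x.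
  suff /choice[c cP] : forall x, exists i, (\bigcup_i C i) x -> C i x by exists c.
  move=> x; have [[i _ Cix]|nC] := pselect ((\bigcup_i C i) x); [exists i|exists i0];
  by [].
have [a aP] := index _ A.
have [b bP] := index _ B.
have [fg fgP] : exists fg : I -> (S -> T) * (T -> S), forall i,
    embeds (A i) (B i) (fg i).1 (fg i).2 /\ embeds (B i) (A i) (fg i).2 (fg i).1.
  suff /choice[fg fgP] : forall i, exists fg : (S -> T) * (T -> S),
      embeds (A i) (B i) fg.1 fg.2 /\ embeds (B i) (A i) fg.2 fg.1 by exists fg.
  by move=> i; have [f [g ?]] := AB i; exists (f, g).
have half (U W : topologicalType) (C : I -> set U) (D : I -> set W) c d
    (f : I -> U -> W) (g : I -> W -> U) :
    trivIset setT C -> trivIset setT D ->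
    (forall i x, C i x -> nbhs x [set y | (\bigcup_j C j) y -> C i y]) ->
    (forall x, (\bigcup_i C i) x -> C (c x) x) ->
    (forall x, (\bigcup_i D i) x -> D (d x) x) ->
    (forall i, embeds (C i) (D i) (f i) (g i)) ->
    embeds (\bigcup_i C i) (\bigcup_i D i) (fun x => f (c x) x)
      (fun y => g (d y) y).
  move=> tC tD oC cP dP fP.
  have cE i x : C i x -> c x = i.
    by move=> Cix; apply: tC => //; exists x; split=> //; apply: cP; exists i.
  have dE i x : D i x -> d x = i.
    by move=> Dix; apply: tD => //; exists x; split=> //; apply: dP; exists i.
  split.
  - by move=> x /cP Cx; exists (c x) => //; case: (fP (c x)) => + _ _; apply.
  - move=> x /cP Cx; have [CD fK _] := fP (c x).
    by rewrite (dE (c x)) ?fK//; exact: CD.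
  - apply/within_contP => x [i _ Cix] V /=; rewrite (cE _ _ Cix).
    have [_ _ /within_contP cf] := fP i.
    move=> /(cf _ Cix); apply: filterS2 (oC _ _ Cix).
    by move=> y /= h1 h2 yC; rewrite (cE i) //; [apply: h2|]; apply: h1.
exists (fun x => (fg (a x)).1 x), (fun y => (fg (b y)).2 y).
by split; [apply: (half _ _ A B a b (fun i => (fg i).1) (fun i => (fg i).2))|
  apply: (half _ _ B A b a (fun i => (fg i).2) (fun i => (fg i).1))] => // i;
  case: (fgP i).
Qed.

(** A compact Hausdorff space is the one-point compactification of the
    complement of any of its points, hence is determined by it: the preimage of
    a closed set that misses [q] is compact and misses [p]. *)
Lemma subhomeo_compact_setD1 (S T : topologicalType) (K : set S) (L : set T)
    (p : S) (q : T) :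
  hausdorff_space S -> hausdorff_space T -> compact K -> compact L ->
  K p -> L q -> subhomeo (K `\ p) (L `\ q) -> subhomeo K L.
Proof.
move=> hS hT cK cL Kp Lq [f [g [fg gf]]].
have half (U W : topologicalType) (C : set U) (D : set W) c d
    (f' : U -> W) (g' : W -> U) :
    hausdorff_space U -> compact D -> C c -> D d ->
    embeds (C `\ c) (D `\ d) f' g' -> embeds (D `\ d) (C `\ c) g' f' ->
    embeds C D (fun x => if x == c then d else f' x)
      (fun y => if y == d then c else g' y).
  move=> hU cD Cc Dd [CD fK /within_contP cf] [DC gK cg]; split.
  - by move=> x Cx; case: eqP => // /eqP xc; case: (CD x) => //; split => //; exact/eqP.
  - move=> x Cx; case: (eqVneq x c) => [->|xc]; first by rewrite eqxx.
    have Cx' : (C `\ c) x by split=> //; exact/eqP.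
    by case: (CD _ Cx') => _ /eqP/negbTE ->; exact: fK.
  - apply/within_contP => x Cx V /=; case: (eqVneq x c) => [->|xc]; last first.
      have Cx' : (C `\ c) x by split=> //; exact/eqP.
      move=> /(cf _ Cx').
      have : nbhs x (~` [set c]).
        apply: open_nbhs_nbhs; split; last exact/eqP.
        by apply: closed_openC; apply: accessible_closed_set1; exact: hausdorff_accessible.
      apply: filterS2 => y /= yc h Cy; rewrite (negbTE (introN eqP yc)); apply: h.
      by split.
    rewrite nbhsE => -[Q [oQ Qd] QV].
    have cDQ : compact (D `&` ~` Q) by apply: compact_closedI => //; exact: open_closedC.
    have cG : closed (g' @` (D `&` ~` Q)).
      apply: compact_closed => //; apply: continuous_compact => //.
      apply: continuous_subspaceW cg => y [Dy Qy]; split=> //.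
      by move=> yd; apply: Qy; rewrite yd.
    have : nbhs c (~` (g' @` (D `&` ~` Q))).
      apply: open_nbhs_nbhs; split; first exact: closed_openC.
      move=> [y [Dy Qy] yc]; case: (DC y) => //; split=> // yd.
      by apply: Qy; rewrite yd.
    apply: filterS => y /= yG Cy; case: eqP => [_|/eqP yc]; first exact: QV.
    apply: QV; apply: contrapT => Qfy; apply: yG.
    have Cy' : (C `\ c) y by split=> //; exact/eqP.
    by exists (f' y); [split=> //; case: (CD _ Cy')|exact: fK].
by eexists; eexists; split; apply: half; eassumption.
Qed.

(** * Sequences of closed sets shrinking to a point *)

Definition shrinks_to (T : topologicalType) (G : nat -> set T) (y : T) : Prop :=
  forall U, nbhs y U -> \forall i \near \oo, G i `<=` U.

(** Only finitely many members of the sequence come near [x], and each of these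
    is closed. *)
Lemma nbhs_locally_finite (T : topologicalType) (G : nat -> set T) (J : set nat)
    (x : T) (U : set T) :
  (forall i, closed (G i)) -> nbhs x U ->
  (\forall i \near \oo, G i `&` U = set0) -> (forall i, J i -> ~ G i x) ->
  nbhs x [set z | forall i, J i -> ~ G i z].
Proof.
move=> clG xU [N _ GN] Gx.
have low n : nbhs x [set z | forall i, (i < n)%N -> J i -> ~ G i z].
  elim: n => [|n]; first by apply: nearW.
  apply: filterS2 (_ : nbhs x [set z | J n -> ~ G n z]) => [z /= hn IH i|].
    by rewrite ltnS leq_eqVlt => /orP[/eqP ->|/IH].
  have [Jn|nJ] := pselect (J n); last by apply: nearW => z /nJ.
  have : nbhs x (~` G n).
    by apply: open_nbhs_nbhs; split; [exact: closed_openC|exact: Gx].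
  by apply: filterS => z + _.
apply: filterS2 (low N) xU => z /= zlow Uz i Ji.
have [iN|Ni] := ltnP i N; first exact: zlow.
by move=> Giz; have : (G i `&` U) z by []; rewrite (GN i).
Qed.

Lemma closed_setU_bigcup (T : topologicalType) (E : set T) (G : nat -> set T)
    (J : set nat) :
  closed E -> (forall i, closed (G i)) ->
  (forall x, ~ E x -> exists2 U, nbhs x U & \forall i \near \oo, G i `&` U = set0) ->
  closed (E `|` \bigcup_(i in J) G i).
Proof.
move=> clE clG acc; rewrite -[X in closed X]setCK; apply: open_closedC.
rewrite openE => x /not_orP[Ex Gx]; rewrite /interior.
have [U xU UG] := acc _ Ex.
have nG : nbhs x [set z | forall i, J i -> ~ G i z].
  by apply: nbhs_locally_finite xU UG _ => // i Ji Gix; apply: Gx; exists i.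
apply: filterS2 nG (open_nbhs_nbhs (conj (closed_openC clE) Ex)).
by move=> z /= Gz Ez [//|[i Ji /Gz]]; exact.
Qed.

Lemma shrinks_to_away (T : topologicalType) (G : nat -> set T) (y x : T) :
  hausdorff_space T -> shrinks_to G y -> x <> y ->
  exists2 U, nbhs x U & \forall i \near \oo, G i `&` U = set0.
Proof.
move=> hT Gy xy; apply: contrapT => nU; apply: xy; apply: hT => A B xA yB.
apply: contrapT => /set0P/negP/negPn/eqP AB0; apply: nU; exists A => //.
apply: filterS (Gy _ yB) => i GB; apply/seteqP; split=> // z [/GB Bz Az].
by rewrite -AB0.
Qed.

Lemma geometric_half_near (R : realType) (c e : R) : 0 < e ->
  \forall i \near \oo, geometric c 2^-1 i < e.
Proof.
move=> e0; have : geometric c 2^-1 @ \oo --> (0 : R).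
  by apply: cvg_geometric; rewrite ger0_norm// invf_lt1// ltr1n.
move=> /cvgrPdist_lt/(_ _ e0); apply: filterS => i.
by rewrite sub0r normrN; exact/le_lt_trans/ler_norm.
Qed.

(** Choose the members one after the other, each inside a ball around [y] that
    misses the previous one and whose radius is at most half the previous
    radius. *)
Lemma disjoint_shrinking_sequence (R : realType) (V : pseudoMetricType R)
    (J : Type) (P : J -> Prop) (F : J -> set V) (y : V) (C : set V) :
  closed C -> ~ C y -> (forall j, P j -> closed (F j) /\ ~ F j y) ->
  (forall e, 0 < e -> exists2 j, P j & F j `<=` ball y e) ->
  exists s : nat -> J,
    [/\ forall i, P (s i), forall i, F (s i) `&` C = set0,
        trivIset [set: nat] (F \o s) & shrinks_to (F \o s) y].
Proof.
move=> clC Cy clF small.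
have away D : closed D -> ~ D y -> exists2 e : R, 0 < e & D `&` ball y e = set0.
  move=> clD Dy.
  have : nbhs y (~` D) by apply: open_nbhs_nbhs; split=> //; exact: closed_openC.
  by move=> /nbhs_ballP[e e0 De]; exists e => //; apply/seteqP; split=> // z [Dz /De].
have [e0 e0_gt0 Ce0] := away _ clC Cy.
(* [next e] is an index together with the radius of the next ball *)
have /choice[next nextP] : forall e, exists n : J * R, 0 < e ->
    [/\ P n.1, F n.1 `<=` ball y e, 0 < n.2,
        n.2 <= e / 2 & F n.1 `&` ball y n.2 = set0].
  move=> e; have [e_gt0|ne] := pselect (0 < e); last first.
    by have [j _ _] := small 1 ltr01; exists (j, 0) => /ne.
  have [j Pj Fj] := small _ e_gt0.
  have [clFj Fjy] := clF _ Pj.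
  have [d d0 Fd] := away _ clFj Fjy.
  exists (j, Num.min d (e / 2)) => _ /=.
  have [dm|dm] := leP d (e / 2); split => //; first exact: divr_gt0.
  apply/seteqP; split=> // z [Fz zd]; rewrite -Fd; split=> //.
  by apply: le_ball zd; exact: ltW.
pose eps i := iter i (fun e => (next e).2) e0.
have eps_gt0 i : 0 < eps i by elim: i => //= i /nextP[].
have eps_half i : eps i <= geometric e0 2^-1 i.
  rewrite /geometric; elim: i => [|i IH]; first by rewrite /= expr0 mulr1.
  have [_ _ _ le2 _] := nextP _ (eps_gt0 i).
  by apply: le_trans le2 _; rewrite /= exprSr mulrA ler_pM2r// invr_gt0.
have eps_le i k : (i <= k)%N -> eps k <= eps i.
  elim: k => [|k IH]; first by rewrite leqn0 => /eqP ->.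
  rewrite leq_eqVlt => /orP[/eqP ->//|/IH]; apply: le_trans.
  have [_ _ _ le2 _] := nextP _ (eps_gt0 k).
  by apply: le_trans le2 _; rewrite ler_pdivrMr// ler_peMr ?ler1n// ltW.
have sub i : F (next (eps i)).1 `<=` ball y (eps i) by have [] := nextP _ (eps_gt0 i).
have disj i k : (i < k)%N -> F (next (eps i)).1 `&` F (next (eps k)).1 = set0.
  move=> ik; apply/seteqP; split=> // z [zi /sub zk].
  have [_ _ _ _ <-] := nextP _ (eps_gt0 i); split=> //.
  by apply: le_ball zk; exact: (eps_le i.+1 k).
exists (fun i => (next (eps i)).1); split.
- by move=> i; have [] := nextP _ (eps_gt0 i).
- move=> i; apply/seteqP; split=> // z [/sub zi Cz]; rewrite -Ce0; split=> //.
  by apply: le_ball zi; exact: (eps_le 0 i).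
- move=> i k _ _ [z [/= zi zk]]; apply/eqP; rewrite eqn_leq.
  apply/andP; split; rewrite leqNgt; apply/negP => /disj E0.
    by have : set0 z by rewrite -E0.
  by have : set0 z by rewrite -E0.
- move=> U /nbhs_ballP[e /= e_gt0 eU].
  apply: filterS (geometric_half_near e0 e_gt0) => i lte.
  apply: subset_trans eU; apply: subset_trans (sub i) _; apply: le_ball.
  exact: le_trans (eps_half i) (ltW lte).
Qed.

(** * The geometry of a building block *)

Section block_geometry.
Variable R : realType.
Notation R3 := 'rV[R]_3.

Lemma le_coord_norm (x : R3) (j : 'I_3) : `|x 0 j| <= `|x|.
Proof.
rewrite -[leRHS]/(mx_norm x) mx_normrE; apply/bigmax_geP; right => /=.
by exists (0, j).
Qed.

Lemma norm_leP (x : R3) (c : R) : 0 <= c ->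
  reflect (forall j, `|x 0 j| <= c) (`|x| <= c).
Proof.
move=> c0; apply: (iffP idP) => [xc j|xc].
  exact: le_trans (le_coord_norm _ _) xc.
rewrite -[leLHS]/(mx_norm x) mx_normrE; apply/bigmax_leP; split => // -[i j] _ /=.
by rewrite ord1.
Qed.

Lemma vec3E (a b c : R) :
  (vec3 a b c 0 0 = a) * (vec3 a b c 0 1 = b) * (vec3 a b c 0 2 = c).
Proof. by rewrite !mxE. Qed.

Lemma forall_ord3 (P : 'I_3 -> Prop) : P 0 -> P 1 -> P 2 -> forall j, P j.
Proof.
move=> P0 P1 P2 [[|[|[|//]]]] i.
- by rewrite (_ : Ordinal i = 0)//; exact: val_inj.
- by rewrite (_ : Ordinal i = 1)//; exact: val_inj.
- by rewrite (_ : Ordinal i = 2)//; exact: val_inj.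
Qed.

Definition block_radius (k : nat) : R := 2 ^- (2 * k.+1 + 1).

Lemma block_radius_gt0 k : 0 < block_radius k.
Proof. by rewrite invr_gt0 exprn_gt0. Qed.

Lemma block_radiusS k : block_radius k.+1 = block_radius k / 4.
Proof.
rewrite /block_radius [(2 * k.+2)%N]mulnS -addnA addnC exprD invfM.
by congr (_ * _^-1); rewrite expr2 -natrM.
Qed.

Lemma block_radius_le k : block_radius k <= 8^-1.
Proof.
elim: k => [|k IH]; first by rewrite /block_radius -natrX.
by rewrite block_radiusS; lra.
Qed.

Lemma block_radius_lt j k : (j < k)%N -> block_radius k <= block_radius j / 4.
Proof.
elim: k => // k IH; rewrite ltnS leq_eqVlt => /orP[/eqP ->|/IH].
  by rewrite block_radiusS.
by have := block_radius_gt0 k; rewrite block_radiusS; lra.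
Qed.

Lemma block_cubeE (d : nat -> R3) k :
  block_cube d k = Cube (d k + vec3 0 0 (2 * block_radius k)) (block_radius k).
Proof.
congr (Cube (_ + vec3 _ _ _) _).
by rewrite /block_radius exprD expr1 invfM mulrCA mulfV ?mulr1.
Qed.

Lemma middle_squareP (x : R3) : middle_square x ->
  [/\ 4^-1 <= x 0 0 <= 3 / 4, 4^-1 <= x 0 1 <= 3 / 4 & x 0 2 = 2^-1].
Proof. by move=> [a + [b + <-]] => /= /[!in_itv]/= ha hb; rewrite !vec3E. Qed.

Variable d : nat -> R3.
Hypothesis d_middle : forall k, middle_square (d k).

Lemma block_cube_coord k x : cube_set (block_cube d k) x ->
  [/\ `|d k 0 0 - x 0 0| <= block_radius k, `|d k 0 1 - x 0 1| <= block_radius k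
    & `|2^-1 + 2 * block_radius k - x 0 2| <= block_radius k].
Proof.
rewrite block_cubeE /cube_set /closed_ball_/=.
move=> /(norm_leP _ (ltW (block_radius_gt0 k))) xk.
have [_ _ dk] := middle_squareP (d_middle k).
by split; [have := xk 0|have := xk 1|have := xk 2];
   rewrite mxE [X in `|X + _|]mxE [X in `|_ + X|]mxE !vec3E ?addr0 ?dk.
Qed.

(** The heights separate the cubes of a block from one another and from the
    continuum at height 1/2. *)
Lemma block_cube_height k x : cube_set (block_cube d k) x ->
  block_radius k <= x 0 2 - 2^-1 <= 3 * block_radius k.
Proof.
by move=> /block_cube_coord[_ _]; rewrite ler_norml => /andP[? ?]; apply/andP; split; lra.
Qed.

Lemma block_cube_disjoint j k x : cube_set (block_cube d j) x ->
  cube_set (block_cube d k) x -> j = k.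
Proof.
have lt i l : (i < l)%N -> cube_set (block_cube d i) x ->
    cube_set (block_cube d l) x -> False.
  move=> il /block_cube_height/andP[xi _] /block_cube_height/andP[_ xl].
  by have := block_radius_lt il; have := block_radius_gt0 i; lra.
by move=> xj xk; case: (ltngtP j k) => // jk; [case: (lt j k)|case: (lt k j)].
Qed.

Lemma block_cube_middle k x : cube_set (block_cube d k) x -> ~ middle_square x.
Proof.
move=> /block_cube_height/andP[xk _] /middle_squareP[_ _ x2].
by move: xk; have := block_radius_gt0 k; rewrite x2; lra.
Qed.

Lemma block_cube_dist k x : cube_set (block_cube d k) x ->
  `|d k - x| <= 3 * block_radius k.
Proof.
move=> xk; have k0 := block_radius_gt0 k.
have [x0 x1 _] := block_cube_coord xk; have /andP[x2 x2'] := block_cube_height xk.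
have [_ _ dk] := middle_squareP (d_middle k).
apply/norm_leP; first lra.
apply: forall_ord3; rewrite mxE [X in _ + X]mxE; [lra|lra|].
by rewrite dk ler_norml; apply/andP; split; lra.
Qed.

Lemma middle_square_unit_cube : @middle_square R `<=` cube_set (unit_cube R).
Proof.
move=> x /middle_squareP[/andP[? ?] /andP[? ?] x2].
rewrite /cube_set /closed_ball_/=; apply/norm_leP => //.
by apply: forall_ord3; rewrite mxE [X in _ + X]mxE vec3E ler_norml ?x2;
   apply/andP; split; lra.
Qed.

Lemma block_cube_unit_cube k :
  cube_set (block_cube d k) `<=` cube_set (unit_cube R).
Proof.
move=> x xk; have [] := block_cube_coord xk; have := block_cube_height xk.
have [/andP[? ?] /andP[? ?] x2] := middle_squareP (d_middle k).
have := block_radius_le k; have := block_radius_gt0 k.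
rewrite !ler_norml => ? ? /andP[? ?] /andP[? ?] /andP[? ?] _.
rewrite /cube_set /closed_ball_/=; apply/norm_leP => //.
by apply: forall_ord3; rewrite mxE [X in _ + X]mxE vec3E ler_norml;
   apply/andP; split; lra.
Qed.

End block_geometry.

Section cube_maps.
Variable R : realType.
Notation R3 := 'rV[R]_3.

Lemma closed_cube_set (Q : cube R) : closed (cube_set Q).
Proof. exact: closed_closed_ball_. Qed.

Lemma cube_mapB (Q : cube R) (x y : R3) :
  cube_map Q x - cube_map Q y = (2 * cube_radius Q) *: (x - y).
Proof.
by rewrite /cube_map opprD addrACA subrr addr0 -scalerBr opprB addrA subrK.
Qed.

Lemma norm_cube_mapB (Q : cube R) (x y : R3) : 0 < cube_radius Q ->
  `|cube_map Q x - cube_map Q y| = 2 * cube_radius Q * `|x - y|.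
Proof. by move=> Q0; rewrite cube_mapB normrZ gtr0_norm// mulr_gt0. Qed.

Lemma cube_map_inj (Q : cube R) : 0 < cube_radius Q -> injective (cube_map Q).
Proof.
move=> Q0 x y /eqP; rewrite -subr_eq0 -normr_eq0 norm_cube_mapB// mulf_eq0.
rewrite gt_eqF/= ?mulr_gt0// normr_eq0 subr_eq0.
by move/eqP.
Qed.

Lemma relativize_unit_cube (Q : cube R) : relativize_cube (unit_cube R) Q = Q.
Proof.
case: Q => c r; rewrite /relativize_cube /cube_map /= subrr scaler0 add0r.
by rewrite mulrAC mulfV ?mul1r// pnatr_eq0.
Qed.

End cube_maps.

(** * The tree of cubes *)

Section cube_tree.
Variable R : realType.
Notation R3 := 'rV[R]_3.
Variables (E : seq nat -> set R3) (d : seq nat -> nat -> R3).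
Hypothesis E_middle : forall f, E f `<=` @middle_square R.
Hypothesis d_E : forall f, range (d f) `<=` E f.

Definition node (f : seq nat) : set R3 := cube_set (cube_at d f).
Definition core (f : seq nat) : set R3 := relativize (E f) (cube_at d f).
Notation rad f := (cube_radius (cube_at d f)).

Let d_middle f k : middle_square (d f k).
Proof. by apply: E_middle; apply: d_E; exists k. Qed.

Lemma rad_rcons f k : rad (rcons f k) = 2 * rad f * block_radius R k.
Proof. by rewrite cube_at_rcons. Qed.

Lemma rad_gt0 f : 0 < rad f.
Proof.
elim/last_ind: f => [|f k IH]; first by rewrite /= invr_gt0.
by rewrite rad_rcons !mulr_gt0// block_radius_gt0.
Qed.

Lemma nodeE f : node f = relativize (cube_set (unit_cube R)) (cube_at d f).
Proof. by rewrite -cube_set_relativize ?rad_gt0// relativize_unit_cube. Qed.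

Lemma node_rcons f k :
  node (rcons f k) = relativize (cube_set (block_cube (d f) k)) (cube_at d f).
Proof. by rewrite /node cube_at_rcons cube_set_relativize ?rad_gt0. Qed.

Lemma closed_node f : closed (node f).
Proof. exact: closed_cube_set. Qed.

Lemma node_rcons_sub f k : node (rcons f k) `<=` node f.
Proof.
rewrite node_rcons nodeE; apply: image_subset.
by apply: block_cube_unit_cube => j; exact: d_middle.
Qed.

Lemma node_cat_sub f g : node (f ++ g) `<=` node f.
Proof.
elim/last_ind: g => [|g k IH]; first by rewrite cats0.
by rewrite -rcons_cat; apply: subset_trans IH; exact: node_rcons_sub.
Qed.

Lemma node_prefix_sub f g : prefix f g -> node g `<=` node f.
Proof. by move=> /prefixP[h ->]; exact: node_cat_sub. Qed.

Lemma core_node f : core f `<=` node f.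
Proof.
rewrite nodeE; apply: image_subset.
by apply: subset_trans (@middle_square_unit_cube R); exact: E_middle.
Qed.

Lemma node_rcons_inj f j k x : node (rcons f j) x -> node (rcons f k) x -> j = k.
Proof.
rewrite !node_rcons => -[y yj <-] [z zk] /(cube_map_inj (rad_gt0 f)) zy.
by rewrite zy in zk; exact: block_cube_disjoint yj zk.
Qed.

Lemma core_node_rcons f k x : core f x -> ~ node (rcons f k) x.
Proof.
rewrite node_rcons => -[y /E_middle ym <-] [z zk] /(cube_map_inj (rad_gt0 f)) zy.
by rewrite zy in zk; exact: block_cube_middle zk ym.
Qed.

(** Two cubes of the tree are nested or disjoint, as cubes with the same parent
    are disjoint. *)
Lemma node_prefix f g x : (size f <= size g)%N -> node f x -> node g x ->
  prefix f g.
Proof.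
elim/last_ind: g f => [|g k IH] f.
  by rewrite leqn0 => /nilP ->.
rewrite size_rcons leq_eqVlt => /orP[/eqP|]; last first.
  rewrite ltnS => fg fx /node_rcons_sub /(IH _ fg fx) /prefixP[h ->].
  by rewrite -cats1 -catA prefix_prefix.
case/lastP: f => [//|f j]; rewrite size_rcons => -[fg] fx gx.
have /prefixP[[|a h] gE] : prefix f g.
- by apply: IH; [rewrite fg|exact: node_rcons_sub fx|exact: node_rcons_sub gx].
- rewrite cats0 in gE; subst g.
  by rewrite (node_rcons_inj fx gx) prefix_refl.
- move: fg; rewrite gE size_cat/= addnS => fg.
  by have := leq_addr (size h) (size f); rewrite -ltnS -fg ltnn.
Qed.

Lemma node_inj f g x : size f = size g -> node f x -> node g x -> f = g.
Proof.
move=> fg fx gx; have /prefixP[h gE] : prefix f g.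
  by apply: node_prefix fx gx; rewrite fg.
move: fg; rewrite gE size_cat -[LHS]addn0 => /eqP; rewrite eqn_add2l eq_sym => /nilP ->.
by rewrite cats0.
Qed.

(** The continuum placed in a cube avoids all cubes below it, so it can only meet
    the cubes above. *)
Lemma core_node_prefix f g x : core f x -> node g x -> prefix g f.
Proof.
move=> cx gx; have fx := core_node cx.
have [gf|fg] := leqP (size g) (size f); first exact: node_prefix gx fx.
have /prefixP[[|k h] gE] := node_prefix (ltnW fg) fx gx.
  by move: fg; rewrite gE cats0 ltnn.
case: (core_node_rcons (k := k) cx).
by apply: node_cat_sub (h) _ _; rewrite cat_rcons -gE.
Qed.

Lemma core_inj f g x : core f x -> core g x -> f = g.
Proof.
move=> fx gx; apply: (@node_inj _ _ x); [|exact: core_node|exact: core_node].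
apply/eqP; rewrite eqn_leq.
have := core_node_prefix fx (core_node gx).
have := core_node_prefix gx (core_node fx).
by move=> /size_prefix -> /size_prefix ->.
Qed.

Lemma block_relativize f :
  relativize (block (E f) (d f)) (cube_at d f) =
  core f `|` \bigcup_k node (rcons f k).
Proof.
rewrite /relativize /block image_setU image_bigcup; congr (_ `|` _).
by apply: eq_bigcupr => k _; rewrite node_rcons.
Qed.

(** Every step of the construction keeps the continua already placed, since
    these avoid the cubes that are replaced. *)
Lemma stageP n x : stage E d n x <->
  (exists2 f, (size f <= n)%N & core f x) \/
  (exists2 f, size f = n.+1 & node f x).
Proof.
elim: n => [|n IH] /=.
  have -> : block (E [::]) (d [::]) =
      relativize (block (E [::]) (d [::])) (cube_at d [::]).
    rewrite /relativize [X in _ = X @` _](_ : _ = id) ?image_id//.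
    by apply/funext => y; rewrite /cube_map/= mulfV ?scale1r ?subrK// pnatr_eq0.
  rewrite block_relativize; split.
    by move=> [cx|[k _ kx]]; [left; exists [::]|right; exists [:: k]].
  move=> [[f]|[[|k [|//]]// _ kx]].
    by rewrite leqn0 => /nilP ->; left.
  by right; exists k.
split.
- move=> [[/IH[[f fn fx] _|[f fn fx] nx]]|[f /= fn]].
  + by left; exists f => //; exact: leqW.
  + by case: nx; exists f.
  + rewrite block_relativize => -[fx|[k _ kx]].
      by left; exists f; rewrite ?fn.
    by right; exists (rcons f k); rewrite ?size_rcons ?fn.
- move=> [[f fn fx]|[f fn fx]].
  + move: fn; rewrite leq_eqVlt => /orP[/eqP fn|]; last rewrite ltnS => fn.
      by right; exists f => //; rewrite block_relativize; left.
    left; split; first by apply/IH; left; exists f.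
    move=> [g /= gn gx]; have /size_prefix := core_node_prefix fx gx.
    by rewrite gn leqNgt ltnS fn.
  + case/lastP: f fn fx => // f k; rewrite size_rcons => -[fn] kx.
    by right; exists f => //; rewrite block_relativize; right; exists k.
Qed.

Notation X := (limit_space E d).

Lemma limit_space_cases n x : X x ->
  (exists2 f, (size f < n)%N & core f x) \/ (exists2 f, size f = n & node f x).
Proof.
move=> Xx; case: n => [|n]; last exact/stageP/Xx.
right; exists [::] => //; have /stageP[[f _ fx]|[f _ fx]] := Xx 0%N I.
  by apply: (@node_cat_sub [::] f); exact: core_node.
exact: (@node_cat_sub [::] f).
Qed.

(** The two kinds of points of the limit space: those on a continuum, and those
    in cubes of every length. *)
Lemma limit_spaceP x : X x <->
  (exists f, core f x) \/ (forall n, exists2 f, size f = n & node f x).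
Proof.
split=> [Xx|[[f fx] n _|fx n _]].
- have [fx|nfx] := pselect (exists f, core f x); [by left|right => n].
  by have [[f _ fx]|//] := limit_space_cases n Xx; case: nfx; exists f.
- apply/stageP; have [fn|nf] := leqP (size f) n; first by left; exists f.
  right; exists (take n.+1 f); first by rewrite size_takel.
  by apply: (@node_cat_sub _ (drop n.+1 f)); rewrite cat_take_drop; exact: core_node.
- by apply/stageP; right; exact: fx.
Qed.

Lemma core_limit_space f : core f `<=` X.
Proof. by move=> x fx; apply/limit_spaceP; left; exists f. Qed.

Lemma rad_le f : rad f <= geometric 1 2^-1 (size f).
Proof.
elim/last_ind: f => [|f k IH]; first by rewrite /= expr0 mul1r invf_le1// ler1n.
rewrite rad_rcons size_rcons /= exprSr mulrA; move: IH => /=.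
have := block_radius_le R k; have := rad_gt0 f; have := block_radius_gt0 R k.
set r := rad f; set u := block_radius R k => u0 r0 u8 rle.
have : r * u <= r * 8^-1 by rewrite ler_pM2l.
by rewrite -mulrA; lra.
Qed.

Lemma node_dist f x y : node f x -> node f y -> `|x - y| <= 2 * rad f.
Proof.
move=> fx fy; rewrite mulr2n mulrDl mul1r.
apply: le_trans (ler_distD (cube_centre (cube_at d f)) _ _) _.
by rewrite lerD// distrC.
Qed.

Lemma node_small e : 0 < e -> exists n, forall f x, (n <= size f)%N -> node f x ->
  node f `<=` ball x e.
Proof.
move=> e0; have e2 : 0 < e / 2 by rewrite divr_gt0.
have [n _ ge] := geometric_half_near 1 e2; exists n => f x nf fx y fy.
rewrite -ball_normE /ball_/=; apply: le_lt_trans (node_dist fx fy) _.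
by have := le_lt_trans (rad_le f) (ge _ nf); lra.
Qed.

End cube_tree.

(** * Topology of the limit space *)

(** A dense sequence may repeat values, but it meets every neighbourhood of a
    point [q] of a connected set with two points infinitely often: otherwise
    only finitely many points of the set are near [q], and [q] is isolated. *)
Lemma connected_dense_often (T : topologicalType) (A : set T) (d : nat -> T)
    (q : T) (U : set T) (N : nat) :
  hausdorff_space T -> connected A -> (exists x, A x /\ x <> q) -> A q ->
  A `<=` closure (range d) -> nbhs q U -> exists2 k, (N <= k)%N & U (d k).
Proof.
move=> hT cA [x [Ax xq]] Aq Ad; rewrite nbhsE => -[Q [oQ Qq] QU].
apply: contrapT => nU; apply: xq.
have cl1 z : closed [set z : T].
  by apply: accessible_closed_set1; exact: hausdorff_accessible.
pose C := [set z | (exists2 k, (k < N)%N & z = d k) /\ z <> q].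
have clC : closed C.
  rewrite (_ : C = [set d k | k in `I_N] `\ q); last first.
    apply/seteqP; split=> z [[k kN]].
      by move=> -> zq; split=> //; exists k.
    by move=> <- zq; split=> //; exists k.
  apply: compact_closed => //; apply: finite_compact.
  exact/finite_setD/finite_image/finite_II.
have isol : A `&` (Q `&` ~` C) = [set q].
  apply/seteqP; split=> [z [Az [Qz Cz]]|z ->]; last by split=> //; split=> // -[].
  apply: contrapT => zq.
  have : nbhs z (Q `&` ~` C `&` ~` [set q]).
    apply: open_nbhs_nbhs; split=> //.
    by do 2 ?apply: openI => //; apply: closed_openC.
  move=> /(Ad _ Az)[_ [[k _ <-] [[Qk Ck] kq]]].
  have [kN|Nk] := ltnP k N; first by apply: Ck; split=> //; exists k.
  by apply: nU; exists k => //; exact: QU.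
have qA : [set q] = A.
  apply: cA; [by exists q| |].
    by exists (Q `&` ~` C) => //; apply: openI => //; apply: closed_openC.
  exists [set q]; first exact: cl1.
  by rewrite setIidr// => z ->.
by rewrite -qA in Ax.
Qed.

Lemma continuous_affine (R : realType) (V : normedModType R) (a : R) (m c : V) :
  continuous (fun x => a *: (x - m) + c).
Proof.
move=> x; apply: cvgD; last exact: cvg_cst.
by apply: cvgZ; [exact: cvg_cst|apply: cvgB; [exact: cvg_id|exact: cvg_cst]].
Qed.

Lemma cube_map_continuous (R : realType) (Q : cube R) : continuous (cube_map Q).
Proof. exact: continuous_affine. Qed.

Section limit_space_topology.
Variable R : realType.
Notation R3 := 'rV[R]_3.
Variables (E : seq nat -> set R3) (d : seq nat -> nat -> R3).
Hypothesis E_middle : forall f, E f `<=` @middle_square R.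
Hypothesis d_E : forall f, range (d f) `<=` E f.
Hypothesis E_compact : forall f, compact (E f).
Hypothesis E_connected : forall f, connected (E f).
Hypothesis E_points : forall f, exists x y, [/\ E f x, E f y & x <> y].
Hypothesis d_closure : forall f, E f `<=` closure (range (d f)).

Notation X := (limit_space E d).
Notation node := (node d).
Notation core := (core E d).
Notation rad f := (cube_radius (cube_at d f)).

Lemma compact_core f : compact (core f).
Proof.
apply: continuous_compact => //; apply: continuous_subspaceT.
exact: cube_map_continuous.
Qed.

Lemma connected_core f : connected (core f).
Proof.
apply: connected_continuous_connected => //; apply: continuous_subspaceT.
exact: cube_map_continuous.
Qed.

Lemma closed_core f : closed (core f).
Proof. by apply: compact_closed; [exact: norm_hausdorff|exact: compact_core]. Qed.

Lemma core_points f : exists x y, [/\ core f x, core f y & x <> y].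
Proof.
have [x [y [Ex Ey xy]]] := E_points f.
exists (cube_map (cube_at d f) x), (cube_map (cube_at d f) y); split.
- by exists x.
- by exists y.
- by move=> /cube_map_inj => /(_ (rad_gt0 d f)).
Qed.

Lemma block_radius_near (e : R) : 0 < e ->
  \forall k \near \oo, block_radius R k < e.
Proof.
move=> e0; apply: filterS (geometric_half_near 1 e0) => k; apply: le_lt_trans.
rewrite /= mul1r.
elim: k => [|k IH].
  by rewrite expr0 (le_trans (block_radius_le _ _))// invf_le1// ler1n.
rewrite block_radiusS exprSr; have := block_radius_gt0 R k.
by set u := block_radius R k in IH *; set v := _ ^+ _ in IH *; lra.
Qed.

Lemma node_core_dist f k x : node (rcons f k) x ->
  exists2 p, core f p & `|p - x| <= 3 * rad (rcons f k).
Proof.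
rewrite node_rcons rad_rcons => -[w wk <-].
exists (cube_map (cube_at d f) (d f k)).
  by exists (d f k) => //; apply: d_E; exists k.
rewrite norm_cube_mapB ?rad_gt0// mulrCA ler_pM2l ?mulr_gt0 ?rad_gt0//.
by apply: block_cube_dist wk => j; apply: E_middle; apply: d_E; exists j.
Qed.

(** The cubes below [f] are small and close to the continuum, so they accumulate
    only there. *)
Lemma closed_core_bigcup f (J : set nat) :
  closed (core f `|` \bigcup_(k in J) node (rcons f k)).
Proof.
apply: closed_setU_bigcup; [exact: closed_core|by move=> k; exact: closed_node|].
move=> x fx; have : nbhs x (~` core f).
  by apply: open_nbhs_nbhs; split=> //; exact: closed_openC (@closed_core f).
move=> /nbhs_ballP[e /= e0 ef]; exists (ball x (e / 2)).
  by apply: nbhsx_ballx; rewrite divr_gt0.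
have r0 := rad_gt0 d f.
have : 0 < e / (12 * rad f) by rewrite divr_gt0// mulr_gt0.
move=> /block_radius_near; apply: filterS => k; rewrite ltr_pdivlMr ?mulr_gt0// => ke.
apply/seteqP; split=> // z [] /node_core_dist[p fp pz] xz; apply: (ef p) => //.
move: xz; rewrite -ball_normE /ball_/= => xz.
apply: le_lt_trans (ler_distD z _ _) _; rewrite distrC in pz.
rewrite [ltRHS]splitr ltr_leD//; apply: le_trans pz _; rewrite rad_rcons.
have -> : 3 * (2 * rad f * block_radius R k) = block_radius R k * (12 * rad f) / 2.
  by field.
by rewrite ler_pM2r ?invr_gt0// ltW.
Qed.

Lemma limit_space_node f x : X x -> node f x ->
  (core f `|` \bigcup_k node (rcons f k)) x.
Proof.
move=> Xx fx.
have [[g gf gx]|[g gf gx]] := limit_space_cases E_middle d_E (size f).+1 Xx.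
- have fg := core_node_prefix E_middle d_E gx fx.
  left; rewrite (node_inj E_middle d_E _ fx (core_node E_middle gx))//.
  by apply/eqP; rewrite eqn_leq size_prefix.
- case/lastP: g gf gx => // g k; rewrite size_rcons => -[gf] kx.
  right; exists k => //.
  by rewrite (node_inj E_middle d_E _ fx (node_rcons_sub E_middle d_E kx)).
Qed.

(** A piece is open in the limit space: by induction, a neighbourhood of the
    parent that also avoids the continuum of the parent and all the other cubes
    below it. That set is closed by [closed_core_bigcup]. *)
Lemma node_open f :
  exists Q : set R3, [/\ open Q, node f `<=` Q & X `&` Q `<=` node f].
Proof.
elim/last_ind: f => [|f k [Q [oQ fQ XQ]]].
  exists setT; split=> // [|x [Xx _]]; first exact: openT.
  by have [[]|[[|//] _]] := limit_space_cases E_middle d_E 0 Xx.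
exists (Q `&` ~` (core f `|` \bigcup_(j in ~` [set k]) node (rcons f j))); split.
- by apply: openI => //; apply: closed_openC; exact: closed_core_bigcup.
- move=> x kx; split; first by apply: fQ; exact: node_rcons_sub E_middle d_E _ _ _ kx.
  move=> [/(core_node_rcons E_middle d_E)/(_ kx)//|[j jk jx]].
  by apply: jk; exact: (node_rcons_inj E_middle d_E jx kx).
- move=> x [Xx [Qx /not_orP[fx kx]]].
  have [//|[j _ jx]] := limit_space_node Xx (XQ _ (conj Xx Qx)).
  have [<-//|/eqP jk] := eqVneq j k; by case: kx; exists j.
Qed.

(** If the complement is not a neighbourhood of [x], then [x] descends through
    cubes of every length: when [x] is in a cube but neither on its continuum
    nor in a cube below it, a neighbourhood of [x] misses the limit space. *)
Lemma closed_limit_space : closed X.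
Proof.
rewrite -[X in closed X]setCK; apply: open_closedC; rewrite openE => x nX.
rewrite /interior; apply: contrapT => nnb; apply: (nX).
apply/(limit_spaceP E_middle d_E); right => n.
elim: n => [|n [f fn fx]].
  exists [::] => //; apply: contrapT => x0; apply: nnb.
  have : nbhs x (~` node [::]).
    by apply: open_nbhs_nbhs; split=> //; exact/closed_openC/closed_node.
  apply: filterS => y y0 Xy; apply: y0.
  by have [[]|[[|//] _]] := limit_space_cases E_middle d_E 0 Xy.
apply: contrapT => nf; have [Q [oQ fQ XQ]] := node_open f; apply: nnb.
have clf := @closed_core_bigcup f setT.
have [fx'|fx'] := pselect ((core f `|` \bigcup_k node (rcons f k)) x).
  case: fx' => [/(core_limit_space E_middle d_E)/nX//|[k _ kx]].
  by case: nf; exists (rcons f k); rewrite ?size_rcons ?fn.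
have : nbhs x (Q `&` ~` (core f `|` \bigcup_k node (rcons f k))).
  apply: open_nbhs_nbhs; split; last by split=> //; exact: fQ.
  by apply: openI => //; exact: closed_openC.
by apply: filterS => y [Qy fy] Xy; apply: fy; apply: limit_space_node => //; exact: XQ.
Qed.

Lemma compact_node f : compact (node f).
Proof.
apply: bounded_closed_compact; last exact: closed_node.
exists (`|cube_centre (cube_at d f)| + rad f); split; first exact: num_real.
move=> M Mlt x xM; apply: ltW; apply: le_lt_trans Mlt.
rewrite -[x](subKr (cube_centre (cube_at d f))).
by apply: le_trans (ler_normB _ _) _; rewrite lerD2l.
Qed.

Lemma compact_limit_space : compact X.
Proof.
apply: (subclosed_compact closed_limit_space (@compact_node [::])).
by move=> x Xx; have [[]|[[|//] _]] := limit_space_cases E_middle d_E 0 Xx.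
Qed.

Lemma compact_limit_space_node f : compact (X `&` node f).
Proof.
by apply: compact_closedI; [exact: compact_limit_space|exact: closed_node].
Qed.

Lemma core_near f p e : core f p -> 0 < e ->
  exists k, node (rcons f k) `<=` ball p e.
Proof.
move=> [q qE <-] e0; have r0 := rad_gt0 d f.
pose de := e / (8 * rad f).
have de0 : 0 < de by rewrite divr_gt0// mulr_gt0.
have [N _ Nde] := block_radius_near de0.
have qpt : exists x, E f x /\ x <> q.
  have [x [y [Ex Ey xy]]] := E_points f.
  have [xq|xq] := pselect (x = q); last by exists x.
  by exists y; split=> // yq; apply: xy; rewrite xq yq.
have [k Nk qk] := connected_dense_often N (@norm_hausdorff _ _)
  (@E_connected f) qpt qE (@d_closure f) (nbhsx_ballx q _ de0).
exists k; rewrite node_rcons => _ [w wk <-].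
rewrite -ball_normE /ball_/= norm_cube_mapB//.
have wd : `|d f k - w| <= 3 * block_radius R k.
  by apply: block_cube_dist wk => j; apply: E_middle; apply: d_E; exists j.
have kde := Nde _ Nk; move: qk; rewrite -ball_normE /ball_/= => qk.
have : `|q - w| < 4 * de.
  by apply: le_lt_trans (ler_distD (d f k) _ _) _; lra.
move=> qw; rewrite -ltr_pdivlMl ?mulr_gt0//; apply: lt_le_trans qw _.
rewrite le_eqVlt; apply/orP; left; apply/eqP; rewrite /de.
by field; rewrite gt_eqF.
Qed.

(** On a continuum, the cubes below it accumulate at [y]. Otherwise [y] is in
    arbitrarily small cubes, each of which contains two disjoint cubes. *)
Lemma limit_space_near y e : X y -> 0 < e ->
  exists2 h, node h `<=` ball y e & ~ node h y.
Proof.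
move=> /(limit_spaceP E_middle d_E)[[f fy] e0|fy e0].
  have [k ke] := core_near fy e0; exists (rcons f k) => //.
  exact: core_node_rcons E_middle d_E _ _ _ fy.
have [n ne] := node_small d e0; have [f fn fx] := fy n.
have fe : node f `<=` ball y e by apply: ne; rewrite ?fn.
have sub k : node (rcons f k) `<=` node f.
  exact: (node_rcons_sub E_middle d_E).
have [y0|y0] := pselect (node (rcons f 0) y).
- exists (rcons f 1); first exact: subset_trans (sub _) fe.
  by move=> /(node_rcons_inj E_middle d_E y0).
- by exists (rcons f 0) => //; exact: subset_trans (sub _) fe.
Qed.

Lemma branch_point (g : nat -> nat) : exists x, forall n, node (mkseq g n) x.
Proof.
pose c n := cube_centre (cube_at d (mkseq g n)).
have c_node m n : (m <= n)%N -> node (mkseq g m) (c n).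
  move=> mn; apply: (node_prefix_sub E_middle d_E (g := mkseq g n)).
    apply/prefixP; exists (drop m (mkseq g n)).
    by rewrite -[LHS](cat_take_drop m) -map_take take_iota (minn_idPl mn).
  by rewrite /node /cube_set /closed_ball_/= subrr normr0 ltW// rad_gt0.
have c0 : (c @ \oo) (node [::]) by exists 0%N => // n _; exact: (c_node 0%N n isT).
have [x [_ cx]] := @compact_node [::] (c @ \oo) _ c0.
exists x => n; apply: closed_node => B xB; apply: cx => //.
by exists n => // m /=; exact: c_node.
Qed.

End limit_space_topology.

(** * Self-similarity *)

Section self_similarity.
Variable R : realType.
Notation R3 := 'rV[R]_3.
Variables (E : nat -> set R3) (d : nat -> nat -> R3).
Hypothesis E_middle : forall n, E n `<=` @middle_square R.
Hypothesis d_E : forall n, range (d n) `<=` E n.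
Hypothesis E_compact : forall n, compact (E n).
Hypothesis E_connected : forall n, connected (E n).
Hypothesis E_points : forall n, exists x y, [/\ E n x, E n y & x <> y].
Hypothesis d_closure : forall n, E n `<=` closure (range (d n)).

Let EE (f : seq nat) := E (size f).
Let dd (f : seq nat) := d (size f).
Let EE_middle f : EE f `<=` @middle_square R. Proof. exact: E_middle. Qed.
Let dd_E f : range (dd f) `<=` EE f. Proof. exact: d_E. Qed.
Let EE_compact f : compact (EE f). Proof. exact: E_compact. Qed.
Let EE_connected f : connected (EE f). Proof. exact: E_connected. Qed.
Let EE_points f : exists x y, [/\ EE f x, EE f y & x <> y].
Proof. exact: E_points. Qed.
Let dd_closure f : EE f `<=` closure (range (dd f)).
Proof. exact: d_closure. Qed.

Notation X := (limit_space EE dd).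
Notation node := (node dd).
Notation core := (core EE dd).
Notation cube_at := (cube_at dd).
Notation rad f := (cube_radius (cube_at f)).

(** The affine map of the cube at [f] onto the cube at [g]. *)
Definition similarity (f g : seq nat) (x : R3) : R3 :=
  (rad g / rad f) *: (x - cube_centre (cube_at f)) + cube_centre (cube_at g).

Lemma similarityK f g : cancel (similarity f g) (similarity g f).
Proof.
move=> x; rewrite /similarity addrK scalerA mulrA divfK ?divff ?scale1r ?subrK//;
  by rewrite gt_eqF// rad_gt0.
Qed.

(** The cubes below [f] and below [g] are built from the same blocks when [f]
    and [g] have the same length. *)
Lemma similarity_cube_map f g h y : size f = size g ->
  similarity f g (cube_map (cube_at (f ++ h)) y) = cube_map (cube_at (g ++ h)) y.
Proof.
move=> fg.
have [rE cE] : rad (g ++ h) = rad g / rad f * rad (f ++ h) /\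
    similarity f g (cube_centre (cube_at (f ++ h))) = cube_centre (cube_at (g ++ h)).
  elim/last_ind: h => [|h k [rE cE]].
    rewrite !cats0 divfK ?gt_eqF ?rad_gt0//.
    by rewrite /similarity subrr scaler0 add0r.
  rewrite -!rcons_cat !cube_at_rcons /=.
  have -> : dd (g ++ h) = dd (f ++ h) by rewrite /dd !size_cat fg.
  rewrite rE; split; first by ring.
  by rewrite /cube_map -cE rE /similarity -[X in _ *: X]addrA scalerDr scalerA addrA
    [2 * (_ * _)]mulrCA.
rewrite /cube_map -cE rE /similarity -[X in _ *: X]addrA scalerDr scalerA addrA.
by rewrite [2 * (_ * _)]mulrCA.
Qed.

Lemma similarity_node f g h x : size f = size g ->
  node (f ++ h) x -> node (g ++ h) (similarity f g x).
Proof.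
move=> fg; rewrite !nodeE => -[y yI <-].
by exists y => //; rewrite similarity_cube_map.
Qed.

Lemma similarity_core f g h x : size f = size g ->
  core (f ++ h) x -> core (g ++ h) (similarity f g x).
Proof.
move=> fg [y yE <-]; exists y; last by rewrite similarity_cube_map.
by move: yE; rewrite /EE !size_cat fg.
Qed.

Lemma similarity_limit_space f g x : size f = size g ->
  X x -> node f x -> X (similarity f g x).
Proof.
move=> fg /(limit_spaceP EE_middle dd_E)[[k kx]|nx] fx;
    apply/(limit_spaceP EE_middle dd_E).
- have /prefixP[h kE] := core_node_prefix EE_middle dd_E kx fx.
  by left; exists (g ++ h); apply: similarity_core; rewrite -?kE.
- right=> n; have [k kn kx] := nx (size f + n)%N.
  have /prefixP[h kE] : prefix f k.
    by apply: (node_prefix EE_middle dd_E _ fx kx); rewrite kn leq_addr.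
  exists (take n (g ++ h)).
    rewrite size_takel// size_cat -fg -size_cat -kE kn; exact: leq_addl.
  apply: (node_cat_sub EE_middle dd_E (g := drop n (g ++ h))).
  by rewrite cat_take_drop; apply: similarity_node; rewrite -?kE.
Qed.

Definition piece f := X `&` node f.

Lemma subhomeo_piece f g : size f = size g -> subhomeo (piece f) (piece g).
Proof.
have half f' g' : size f' = size g' ->
    embeds (piece f') (piece g') (similarity f' g') (similarity g' f').
  move=> fg; split=> [x [Xx fx]|x _|].
  - split; first exact: similarity_limit_space.
    by have := @similarity_node f' g' [::] x fg; rewrite !cats0; apply.
  - exact: similarityK.
  - apply: continuous_subspaceT; exact: continuous_affine.
by move=> fg; exists (similarity f g), (similarity g f); split; exact: half.
Qed.

Lemma subhomeo_core f : subhomeo (core f) (EE f).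
Proof.
pose Q := cube_at f; have r0 : 0 < 2 * cube_radius Q by rewrite mulr_gt0// rad_gt0.
pose u (y : R3) := (2 * cube_radius Q)^-1 *: (y - cube_centre Q) + mid R.
have uK x : u (cube_map Q x) = x.
  by rewrite /u /cube_map addrK scalerA mulVf ?scale1r ?subrK// gt_eqF.
have cmK y : cube_map Q (u y) = y.
  by rewrite /u /cube_map addrK scalerA mulfV ?scale1r ?subrK// gt_eqF.
exists u, (cube_map Q); split; split.
- by move=> _ [x Ex <-]; rewrite uK.
- by move=> x _; exact: cmK.
- by apply: continuous_subspaceT; exact: continuous_affine.
- by move=> x Ex; exists x.
- by move=> x _; exact: uK.
- by apply: continuous_subspaceT; exact: cube_map_continuous.
Qed.

(** * Removing a piece or a point *)
Lemma piece_rel_open f x : piece f x -> nbhs x [set y | X y -> piece f y].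
Proof.
move=> [Xx fx]; have [Q [oQ fQ XQ]] := node_open EE_middle dd_E EE_compact f.
have : nbhs x Q by apply: open_nbhs_nbhs; split=> //; exact: fQ.
by apply: filterS => y Qy Xy; split=> //; exact: XQ.
Qed.

Lemma nbhs_not_node f x : ~ node f x -> nbhs x (~` node f).
Proof.
by move=> fx; apply: open_nbhs_nbhs; split=> //; exact/closed_openC/closed_node.
Qed.

Lemma compact_piece f : compact (piece f).
Proof. exact: compact_limit_space_node. Qed.

Lemma compact_pieceD f g : compact (piece f `\` node g).
Proof.
have [Q [oQ gQ XQ]] := node_open EE_middle dd_E EE_compact g.
rewrite (_ : _ `\` _ = piece f `&` ~` Q).
  by apply: compact_closedI; [exact: compact_piece|exact: open_closedC].
apply/seteqP; split=> x [[Xx fx] gx]; split=> //.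
  by move=> Qx; apply: gx; exact: XQ.
by move=> /gQ.
Qed.

Lemma shrinks_to_cons (G : nat -> set R3) y :
  shrinks_to (fun i => G i.+1) y -> shrinks_to G y.
Proof.
by move=> Gy U /Gy[N _ NU]; exists N.+1 => // -[//|i] /= iN; exact: NU.
Qed.

Lemma not_bigcup_node_nbhs (G : nat -> seq nat) (p x : R3) :
  shrinks_to (node \o G) p -> x <> p -> (forall i, ~ node (G i) x) ->
  nbhs x [set z | forall i, ~ node (G i) z].
Proof.
move=> Gp xp Gx.
have [U xU UG] := shrinks_to_away (@norm_hausdorff _ _) Gp xp.
have := @nbhs_locally_finite _ (node \o G) setT x U
  (fun i => @closed_node _ _ _) xU UG (fun i _ => Gx i).
by apply: filterS => z h i; exact: h.
Qed.

(** Copies [node (s i)] of the piece at [g] converge to a point [p] of the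
    continuum at [f]. Moving the first copy into the hole left by [g] and each
    further copy into the place of its predecessor fills the hole; this is
    glued from homeomorphisms away from [p], and extends to [p] by
    compactness. *)
Lemma subhomeo_pieceD f g : prefix f g -> (size f < size g)%N ->
  subhomeo (piece f `\` node g) (piece f).
Proof.
move=> /prefixP[[|k h] gE] fg; first by move: fg; rewrite gE cats0 ltnn.
have [p [_ [fp _ _]]] := core_points dd EE_points f.
have p_deep j : (size f < size j)%N -> ~ node j p.
  move=> fj /(core_node_prefix EE_middle dd_E fp)/size_prefix.
  by rewrite leqNgt fj.
pose P j := prefix f j /\ size j = size g.
have [s [sP sg ts sp]] : exists s : nat -> seq nat,
    [/\ forall i, P (s i), forall i, node (s i) `&` node g = set0,
        trivIset [set: nat] (node \o s) & shrinks_to (node \o s) p].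
  apply: disjoint_shrinking_sequence.
  - exact: closed_node.
  - exact: p_deep.
  - by move=> j [_ jg]; split; [exact: closed_node|apply: p_deep; rewrite jg].
  - move=> e e0; have [k' k'e] := core_near EE_middle dd_E EE_connected EE_points
      dd_closure fp e0.
    exists (rcons f k' ++ nseq (size h) 0%N).
      split; first by rewrite cat_rcons prefix_prefix.
      by rewrite gE !size_cat size_rcons size_nseq/= addSnnS.
    apply: subset_trans k'e; exact: (@node_cat_sub _ _ _ EE_middle dd_E).
(* the hole followed by the copies that are shifted into it *)
pose G i := if i is i'.+1 then s i' else g.
have Gf i : node (G i) `<=` node f.
  apply: (node_prefix_sub EE_middle dd_E); case: i => [|i]/=.
    by rewrite gE prefix_prefix.
  by case: (sP i).
have Gsize i : size (G i) = size g by case: i => [|i]//=; case: (sP i).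
have Gp : shrinks_to (node \o G) p by exact: shrinks_to_cons.
have np i : ~ node (G i) p by apply: p_deep; rewrite Gsize.
have tG : trivIset [set: nat] (node \o G).
  have s0 i x : node (s i) x -> ~ node g x.
    by move=> ix gx; have : set0 x by rewrite -(sg i).
  move=> [|i] [|j] _ _ [x [/= ix jx]] //.
  - by case: (s0 _ _ jx).
  - by case: (s0 _ _ ix).
  - by congr _.+1; apply: ts => //; exists x.
pose W := piece f `\ p `\` \bigcup_i node (G i).
have Wopen x : W x -> nbhs x [set y | X y /\ y <> p -> W y].
  move=> [[fx xp] Gx]; have nG : nbhs x [set z | forall i, ~ node (G i) z].
    by apply: not_bigcup_node_nbhs Gp xp _ => i ix; apply: Gx; exists i.
  apply: filterS2 (piece_rel_open fx) nG => y /= fy Gy [Xy yp].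
  by split; [split=> //; exact: fy|move=> [i _ /Gy]].
pose A i := if i is i'.+1 then piece (G i'.+1) else W.
pose B i := if i is i'.+1 then piece (G i') else W.
apply: (@subhomeo_compact_setD1 _ _ _ _ p p).
- exact: norm_hausdorff.
- exact: norm_hausdorff.
- exact: compact_pieceD.
- exact: compact_piece.
- by split; [split; [exact: core_limit_space fp|exact: core_node fp]|exact: p_deep].
- by split; [exact: core_limit_space fp|exact: core_node fp].
have XA : piece f `\` node g `\ p = \bigcup_i A i.
  apply/seteqP; split=> [x [[[Xx fx] gx] xp]|x [[|i] _ /=]].
  - have [[[|i] _ /= ix]|nx] := pselect ((\bigcup_i node (G i)) x).
    + by [].
    + by exists i.+1.
    + by exists 0%N.
  - by move=> [[fx xp] Gx]; do 2 split => //; move=> gx; apply: Gx; exists 0%N.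
  - move=> [Xx ix]; split; last by move=> xp; apply: (np i.+1); rewrite -xp.
    split; first by split => //; exact: (Gf i.+1).
    by move=> gx; have := tG i.+1 0%N I I (ex_intro _ x (conj ix gx)).
have XB : piece f `\ p = \bigcup_i B i.
  apply/seteqP; split=> [x [[Xx fx] xp]|x [[|i] _ /=]].
  - have [[i _ /= ix]|nx] := pselect ((\bigcup_i node (G i)) x).
    + by exists i.+1.
    + by exists 0%N.
  - by move=> [[]].
  - move=> [Xx ix]; split; last by move=> xp; apply: (np i); rewrite -xp.
    by split => //; exact: (Gf i).
have Xp : forall x, (piece f `\ p) x -> X x /\ x <> p by move=> x [[]].
have Xpg : forall x, (piece f `\` node g `\ p) x -> X x /\ x <> p by move=> x [[[]]].
rewrite XA XB; apply: (subhomeo_bigcup 0%N).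
- move=> [|i] [|j] _ _ [x [/=]] //.
  + by move=> [_ Gx] [_ jx]; case: Gx; exists j.+1.
  + by move=> [_ ix] [_ Gx]; case: Gx; exists i.+1.
  + by move=> [_ ix] [_ jx]; apply: tG => //; exists x.
- move=> [|i] [|j] _ _ [x [/=]] //.
  + by move=> [_ Gx] [_ jx]; case: Gx; exists j.
  + by move=> [_ ix] [_ Gx]; case: Gx; exists i.
  + by move=> [_ ix] [_ jx]; congr _.+1; apply: tG => //; exists x.
- rewrite -XA => -[|i] x /=.
    by move=> /Wopen; apply: filterS => y Wy /Xpg.
  by move=> /piece_rel_open; apply: filterS => y iy /Xpg[/iy].
- rewrite -XB => -[|i] x /=.
    by move=> /Wopen; apply: filterS => y Wy /Xp.
  by move=> /piece_rel_open; apply: filterS => y iy /Xp[/iy].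
- move=> [|i]/=; first exact: subhomeo_refl.
  by apply: subhomeo_piece; rewrite -[LHS]/(size (G i.+1)) !Gsize.
Qed.

Lemma branch_separates (g : nat -> nat) x y : (forall n, node (mkseq g n) x) ->
  x <> y -> exists N, forall n, (N <= n)%N -> ~ node (mkseq g n) y.
Proof.
move=> gx /eqP; rewrite -subr_eq0 -normr_gt0 => xy.
have [N Nsmall] := node_small dd xy; exists N => n Nn ny.
have : ball x `|x - y| y by apply: (Nsmall (mkseq g n)) (gx n) _ ny; rewrite size_mkseq.
by rewrite -ball_normE /ball_/= ltxx.
Qed.

Lemma mkseq_prefix (g : nat -> nat) m n : (m <= n)%N ->
  prefix (mkseq g m) (mkseq g n).
Proof.
move=> mn; apply/prefixP; exists (drop m (mkseq g n)).
by rewrite -[LHS](cat_take_drop m) -map_take take_iota (minn_idPl mn).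
Qed.

(** Pieces [h i] converge to [y], and [b i] is a piece inside [h i]; the cubes
    [c i] shrink to [x]. The layer between [c i] and [c i.+1] is homeomorphic to
    the piece [c i], and [h i] minus [b i] to [h i], both by
    [subhomeo_pieceD]. So the layers around [x] can be moved to the piece [c 0]
    and the pieces [b i], while each [h i] is moved onto [h i] minus
    [b i]. *)
Lemma subhomeo_limit_spaceD (g : nat -> nat) x y : (forall n, node (mkseq g n) x) ->
  X y -> y <> x -> subhomeo (X `\ x `\ y) (X `\ y).
Proof.
move=> gx Xy yx.
have [N Ny] := branch_separates gx (not_eq_sym yx).
have [h [hy hN th hsh]] : exists h : nat -> seq nat,
    [/\ forall i, ~ node (h i) y, forall i, node (h i) `&` node (mkseq g N) = set0,
        trivIset [set: nat] (node \o h) & shrinks_to (node \o h) y].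
  apply: (disjoint_shrinking_sequence (P := fun j => ~ node j y) (F := node)).
  - exact: closed_node.
  - exact: Ny.
  - by move=> j jy; split=> //; exact: closed_node.
  - move=> e e0.
    have [j je jy] := limit_space_near EE_middle dd_E EE_connected EE_points
      dd_closure Xy e0.
    by exists j.
(* the lengths grow fast enough for [b m], of the same length as [c m.+1], to
   extend [h m] properly *)
pose fix l m := if m is m'.+1 then (size (h m') + (l m').+1)%N else N.
have lS m : (l m < l m.+1)%N by rewrite /= leq_addl.
have l_mono m n : (m <= n)%N -> (l m <= l n)%N.
  elim: n => [|n IH]; first by rewrite leqn0 => /eqP ->.
  rewrite leq_eqVlt => /orP[/eqP ->//|/IH mn]; exact: leq_trans mn (ltnW (lS n)).
have l_ge m : (m <= l m)%N by elim: m => // m IH; exact: leq_ltn_trans IH (lS m).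
pose c m := mkseq g (l m).
pose b m := h m ++ nseq (l m).+1 0%N.
have csub m n : (m <= n)%N -> node (c n) `<=` node (c m).
  move=> mn; apply: (node_prefix_sub EE_middle dd_E).
  by apply: mkseq_prefix; exact: l_mono.
have bsub m : node (b m) `<=` node (h m) by exact: (node_cat_sub EE_middle dd_E).
have hc i z : node (h i) z -> ~ node (c 0%N) z.
  by move=> iz cz; have : set0 z by rewrite -(hN i).
have cx m : node (c m) x by exact: gx.
have cy m : ~ node (c m) y by apply: Ny; exact: (l_mono 0%N m).
have hx i : ~ node (h i) x by move=> /hc; apply.
have th' i j z : node (h i) z -> node (h j) z -> i = j.
  by move=> iz jz; apply: th => //; exists z.
have c_level z : z <> x -> node (c 0%N) z ->
    exists m, node (c m) z /\ ~ node (c m.+1) z.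
  move=> zx c0; apply: contrapT => nm; have cz m : node (c m) z.
    by elim: m => // m IH; apply: contrapT => mz; apply: nm; exists m.
  have [M Mz] := branch_separates gx (not_eq_sym zx).
  exact: (Mz (l M)) (cz M).
pose W := X `\ y `\` (node (c 0%N) `|` \bigcup_i node (h i)).
pose V m := piece (h m).
(* the second partition is the image of the first: for [false], the layer number
   [m.+1] goes to the piece [b m] *)
pose A (i : bool * nat) := match i with
  | (true, 0%N) => W
  | (true, m.+1) => V m
  | (false, m) => piece (c m) `\` node (c m.+1) end.
pose B (i : bool * nat) := match i with
  | (true, 0%N) => W
  | (true, m.+1) => V m `\` node (b m)
  | (false, 0%N) => piece (c 0%N)
  | (false, m.+1) => piece (b m) end.
have XA : X `\ x `\ y = \bigcup_i A i.
  apply/seteqP; split=> [z [[Xz zx] zy]|z [[[] [|m]] _ /=]].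
  - have [[i _ /= iz]|hz] := pselect ((\bigcup_i node (h i)) z).
      by exists (true, i.+1).
    have [c0|c0] := pselect (node (c 0%N) z); last first.
      by exists (true, 0%N) => //; split => //; case.
    by have [m [mz mz']] := c_level _ zx c0; exists (false, m).
  - move=> [[Xz zy] cz]; do 2 split => //; move=> zx; apply: cz; left.
    by rewrite zx; exact: cx.
  - move=> [Xz mz]; split; [split=> // zx; apply: (hx m); rewrite -zx//|].
    by move=> zy; apply: (hy m); rewrite -zy.
  - move=> [[Xz mz] mz']; split; [split=> // zx; apply: mz'; rewrite zx; exact: cx|].
    by move=> zy; apply: (cy 0%N); rewrite -zy.
  - move=> [[Xz mz] mz']; split; [split=> // zx; apply: mz'; rewrite zx; exact: cx|].
    by move=> zy; apply: (cy m.+1); rewrite -zy.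
have XB : X `\ y = \bigcup_i B i.
  apply/seteqP; split=> [z [Xz zy]|z [[[] [|m]] _ /=]].
  - have [[i _ /= iz]|hz] := pselect ((\bigcup_i node (h i)) z).
      have [bz|bz] := pselect (node (b i) z); first by exists (false, i.+1).
      by exists (true, i.+1).
    have [c0|c0] := pselect (node (c 0%N) z); first by exists (false, 0%N).
    by exists (true, 0%N) => //; split => //; case.
  - by move=> [].
  - by move=> [[Xz mz] _]; split=> // zy; apply: (hy m); rewrite -zy.
  - by move=> [Xz mz]; split=> // zy; apply: (cy 0%N); rewrite -zy.
  - by move=> [Xz /bsub mz]; split=> // zy; apply: (hy m); rewrite -zy.
have Wopen z : W z -> nbhs z [set t | X t /\ t <> y -> W t].
  move=> [[Xz zy] cz].
  have nh : nbhs z [set t | forall i, ~ node (h i) t].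
    by apply: not_bigcup_node_nbhs hsh zy _ => i iz; apply: cz; right; exists i.
  have nc : nbhs z (~` node (c 0%N)).
    by apply: nbhs_not_node => zc; apply: cz; left.
  by apply: filterS2 nh nc => t ht ct tXy; split => // -[//|[i _ /ht]].
have PDopen f f' z : (piece f `\` node f') z ->
    nbhs z [set t | X t -> (piece f `\` node f') t].
  move=> [fz fz']; have := piece_rel_open fz.
  by apply: filterS2 (nbhs_not_node fz') => t ft' ft Xt; split=> //; exact: ft.
have Popen f z : piece f z -> nbhs z [set t | X t -> piece f t].
  exact: piece_rel_open.
have sub1 t : (X `\ x `\ y) t -> X t /\ t <> y by move=> [[]].
rewrite XA XB; apply: (subhomeo_bigcup (true, 0%N)).
- have cc i j z : (i < j)%N -> node (c j) z -> ~ node (c i.+1) z -> False.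
    by move=> ij jz; apply; apply: csub jz.
  move=> [[] [|i]] [[] [|j]] _ _ [z []] //=.
  + by move=> [_ cz] [_ jz]; case: cz; right; exists j.
  + by move=> [_ cz] [[_ jz] _]; case: cz; left.
  + by move=> [_ cz] [[_ jz] _]; case: cz; left; apply: csub jz.
  + by move=> [_ iz] [_ cz]; case: cz; right; exists i.
  + by move=> [_ iz] [_ jz]; rewrite (th' _ _ _ iz jz).
  + by move=> [_ iz] [[_ jz] _]; case: (hc _ _ iz).
  + by move=> [_ iz] [[_ jz] _]; case: (hc _ _ iz); apply: csub jz.
  + by move=> [[_ jz] _] [_ cz]; case: cz; left.
  + by move=> [[_ jz] _] [_ iz]; case: (hc _ _ iz).
  + by move=> [_ iz] [[_ jz] _]; case: (cc 0%N j.+1 z).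
  + by move=> [[_ jz] _] [_ cz]; case: cz; left; apply: csub jz.
  + by move=> [[_ jz] _] [_ iz]; case: (hc _ _ iz); apply: csub jz.
  + by move=> [[_ jz] _] [_ iz]; case: (cc 0%N i.+1 z).
  + move=> [[_ iz] iz'] [[_ jz] jz'].
    have [ij|ji|->//] := ltngtP i j; [case: (cc i.+1 j.+1 z)|case: (cc j.+1 i.+1 z)] => //.
- move=> [[] [|i]] [[] [|j]] _ _ [z []] //=.
  + by move=> [_ cz] [[_ jz] _]; case: cz; right; exists j.
  + by move=> [_ cz] [_ jz]; case: cz; left.
  + by move=> [_ cz] [_ /bsub jz]; case: cz; right; exists j.
  + by move=> [[_ iz] _] [_ cz]; case: cz; right; exists i.
  + by move=> [[_ iz] _] [[_ jz] _]; rewrite (th' _ _ _ iz jz).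
  + by move=> [[_ iz] _] [_ jz]; case: (hc _ _ iz).
  + by move=> [[_ iz] biz] [_ bjz]; case: biz; rewrite (th' _ _ _ iz (bsub _ _ bjz)).
  + by move=> [_ jz] [_ cz]; case: cz; left.
  + by move=> [_ jz] [[_ iz] _]; case: (hc _ _ iz).
  + by move=> [_ jz] [_ /bsub iz]; case: (hc _ _ iz).
  + by move=> [_ /bsub jz] [_ cz]; case: cz; right; exists i.
  + by move=> [_ bjz] [[_ iz] biz]; case: biz; rewrite (th' _ _ _ iz (bsub _ _ bjz)).
  + by move=> [_ /bsub iz] [_ jz]; case: (hc _ _ iz).
  + by move=> [_ /bsub iz] [_ /bsub jz]; rewrite (th' _ _ _ iz jz).
- rewrite -XA => -[[] [|i]] z /=.
  + by move=> /Wopen; apply: filterS => t Wt /sub1.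
  + by move=> /Popen; apply: filterS => t Pt /sub1[/Pt].
  + by move=> /PDopen; apply: filterS => t Pt /sub1[/Pt].
  + by move=> /PDopen; apply: filterS => t Pt /sub1[/Pt].
- rewrite -XB => -[[] [|i]] z /=.
  + by move=> /Wopen; apply: filterS.
  + by move=> /PDopen; apply: filterS => t Pt [/Pt].
  + by move=> /Popen; apply: filterS => t Pt [/Pt].
  + by move=> /Popen; apply: filterS => t Pt [/Pt].
- have shift m : subhomeo (piece (c m) `\` node (c m.+1)) (piece (c m)).
    apply: subhomeo_pieceD => //; first by apply: mkseq_prefix; exact: ltnW (lS m).
    by rewrite !size_mkseq; exact: lS.
  move=> [[] [|i]].
  + exact: subhomeo_refl.
  + apply: subhomeo_sym; apply: subhomeo_pieceD => //; first exact: prefix_prefix.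
    by rewrite size_cat size_nseq -[X in (X < _)%N]addn0 ltn_add2l.
  + exact: shift.
  + apply: subhomeo_trans (shift _) _; apply: subhomeo_piece => //.
    by rewrite size_mkseq size_cat size_nseq.
Qed.

Lemma branch_limit_space g x : (forall n, node (mkseq g n) x) -> X x.
Proof.
move=> gx; apply/(limit_spaceP EE_middle dd_E); right=> n.
by exists (mkseq g n); rewrite ?size_mkseq.
Qed.

Lemma branch_point_limit g x : (forall n, node (mkseq g n) x) -> ~ compact (X `\ x).
Proof.
move=> gx /(compact_closed (@norm_hausdorff _ _)) cl.
have : (X `\ x) x; last by case=> _ /(_ erefl).
apply: cl => U /nbhs_ballP[e /= e0 eU].
have [n ne] := node_small dd e0.
have [p [q [fp fq pq]]] := core_points dd EE_points (mkseq g n).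
have sub z : core (mkseq g n) z -> X z /\ U z.
  move=> fz; split; first exact: core_limit_space fz.
  by apply: eU; apply: (ne _ _ _ (gx n)); [rewrite size_mkseq|exact: core_node fz].
have [px|px] := pselect (p = x).
  have [Xq Uq] := sub _ fq; exists q; split=> //; split=> // qx.
  by apply: pq; rewrite px qx.
by have [Xp Up] := sub _ fp; exists p.
Qed.

(** The card of the whole space at [x] itself is a card of the complement of [x]
    at any second point [y] that lies in infinitely many cubes, by exchanging
    the roles of [x] and [y]. *)
Lemma limit_space_non_reconstructible : ~ reconstructible X.
Proof.
have [x gx] := branch_point EE_middle dd_E (fun=> 0%N).
have [y gy] := branch_point EE_middle dd_E (fun=> 1%N).
have xy : x <> y.
  move=> xy; have := gy 1%N; rewrite -xy => /(node_inj EE_middle dd_E _ (gx 1%N)).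
  by move=> /(_ erefl).
have Xx := branch_limit_space gx; have Xy := branch_limit_space gy.
have shX (u v : R3) g : (forall n, node (mkseq g n) u) -> X v -> v <> u ->
    homeo_class (X `\ u `\ v) = homeo_class (X `\ v).
  move=> gu Xv vu; apply: homeo_class_eq; apply: subhomeo_homeomorphic.
  exact: subhomeo_limit_spaceD gu Xv vu.
move=> /(_ (X `\ x)) rec.
have : homeomorphic (X `\ x) X.
  apply: rec; apply/funext => C; apply/propext; split.
  - move=> /deck_subset[z [Xz zx] ->]; apply/deck_subset; exists z => //.
    exact: shX gx Xz zx.
  - move=> /deck_subset[z Xz ->]; apply/deck_subset.
    have [->|zx] := pselect (z = x); last first.
      by exists z; [split|rewrite (shX _ _ _ gx Xz zx)].
    exists y; first by split=> // /esym.
    by rewrite -(shX _ _ _ gy Xx xy) !setDDl setUC.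
move=> [f [g [_ cg fK gK]]].
apply: (branch_point_limit gx); apply/compact_set_type.
have cX : compact [set: X].
  by apply/compact_set_type; exact: (compact_limit_space EE_middle dd_E EE_compact).
rewrite (_ : [set: _] = g @` [set: X]).
  by apply: continuous_compact => //; exact: continuous_subspaceT.
by apply/seteqP; split=> // z _; exists (f z).
Qed.

(** * Components and clopen parts *)

(** A connected set that meets a piece lies in it. If it has two points, it
    cannot be in pieces of every length, so each of its points is on some
    continuum; two distinct continua are separated by a piece. *)
Lemma connected_in_core (K : set R3) : K `<=` X -> connected K ->
  (exists x y, [/\ K x, K y & x <> y]) -> exists f, K `<=` core f.
Proof.
move=> KX cK [u [v [Ku Kv uv]]].
have Knode f z : K z -> node f z -> K `<=` node f.
  move=> Kz fz; have [Q [oQ fQ XQ]] := node_open EE_middle dd_E EE_compact f.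
  have -> : K = K `&` node f.
    apply/esym; apply: cK; first by exists z.
      exists Q => //; apply/seteqP; split=> t [Kt]; first by move=> /fQ.
      by move=> Qt; split=> //; apply: XQ; split=> //; exact: KX.
    by exists (node f) => //; exact: closed_node.
  by move=> t [].
have Kcore z : K z -> exists f, core f z.
  move=> Kz; have /(limit_spaceP EE_middle dd_E)[//|nz] := KX _ Kz; exfalso.
  apply: uv; apply/eqP; rewrite -subr_eq0 -normr_eq0; apply: contraT => uv.
  have uv0 : 0 < `|u - v| by rewrite lt_neqAle eq_sym uv normr_ge0.
  have [n ne] := node_small dd uv0; have [f fn fz] := nz n.
  have := ne f u _ (Knode _ _ Kz fz _ Ku) v (Knode _ _ Kz fz _ Kv).
  by rewrite -ball_normE /ball_/= ltxx fn => /(_ (leqnn n)).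
have [f fu] := Kcore _ Ku; exists f => z Kz; have [g gz] := Kcore _ Kz.
have gu := Knode _ _ Kz (core_node EE_middle gz) _ Ku.
have fz := Knode _ _ Ku (core_node EE_middle fu) _ Kz.
have /size_prefix fg := core_node_prefix EE_middle dd_E gz fz.
have /size_prefix gf := core_node_prefix EE_middle dd_E fu gu.
rewrite (node_inj EE_middle dd_E _ fz (core_node EE_middle gz))//.
by apply/eqP; rewrite eqn_leq fg gf.
Qed.

Definition clopen_part (B : set R3) : Prop :=
  [/\ B `<=` X, closed B & forall x, B x -> nbhs x [set y | X y -> B y]].

Lemma core_in_clopen (B : set R3) f z : clopen_part B ->
  core f z -> B z -> core f `<=` B.
Proof.
move=> [BX cB oB] fz Bz.
have -> : core f = core f `&` B.
  apply/esym; have cf := @connected_core _ _ dd EE_connected f; apply: cf.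
  - by exists z.
  - exists (\bigcup_(Q in [set Q | open Q /\ X `&` Q `<=` B]) Q).
      by apply: bigcup_open => Q [].
    apply/seteqP; split=> t [ft].
      move=> /oB; rewrite nbhsE => -[Q [oQ Qt] QB]; split => //.
      by exists Q => //; split=> // s [Xs /QB]; exact.
    by move=> [Q [oQ QB] Qt]; split=> //; apply: QB; split=> //; exact: core_limit_space ft.
  - by exists B.
by move=> t [].
Qed.

(** The image of [core h] in [B'] lies in some [core k], which lies in [B'] as it
    is connected; the image of [core k] in [B] lies in a single continuum,
    which must be [core h]. So [core h] and [core k] are homeomorphic, [h] and
    [k] have the same length, and [k] extends [f]. *)
Lemma clopen_part_level (B B' : set R3) h f :
  (forall l m, l <> m -> ~ homeomorphic (E l) (E m)) ->
  clopen_part B -> clopen_part B' -> subhomeo B B' ->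
  core h `<=` B -> B' `<=` node f -> (size f <= size h)%N.
Proof.
move=> nE BC BC' [u [v [uv vu]]] hB Bf'; rewrite leqNgt; apply/negP => hf.
have [BX _ _] := BC; have [BX' _ _] := BC'.
have [uB uK cu] := uv; have [vB vK cv] := vu.
have image (C : set R3) (D D' : set R3) (s t : R3 -> R3) : embeds D D' s t ->
    C `<=` D -> connected C -> (exists x y, [/\ C x, C y & x <> y]) ->
    connected (s @` C) /\ exists x y, [/\ (s @` C) x, (s @` C) y & x <> y].
  move=> [sD sK cs] CD cC [x [y [Cx Cy xy]]]; split.
    by apply: connected_continuous_connected => //; exact: continuous_subspaceW cs.
  exists (s x), (s y); split; [by exists x|by exists y|move=> sxy].
  by apply: xy; rewrite -(sK x) ?sxy ?sK//; exact: CD.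
have hcon := @connected_core _ _ dd EE_connected h.
have [cI pI] := image _ _ _ _ _ uv hB hcon (core_points dd EE_points h).
have [|k Ik] := connected_in_core _ cI pI.
  by move=> _ [x /hB/uB/BX' ? <-].
have [x [_ [hx _ _]]] := core_points dd EE_points h.
have kux : core k (u x) by apply: Ik; exists x.
have Bux : B' (u x) by apply: uB; exact: hB.
have kB : core k `<=` B' by exact: core_in_clopen Bux.
have kcon := @connected_core _ _ dd EE_connected k.
have [cJ pJ] := image _ _ _ _ _ vu kB kcon (core_points dd EE_points k).
have [|j Jj] := connected_in_core _ cJ pJ.
  by move=> _ [y /kB/vB/BX ? <-].
have jh : j = h.
  apply: (core_inj EE_middle dd_E _ hx); apply: Jj; exists (u x) => //.
  by apply: uK; exact: hB.
rewrite jh in Jj.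
have hk : subhomeo (core h) (core k).
  exists u, v; split; split.
  - by move=> y hy; apply: Ik; exists y.
  - by move=> y /hB /uK.
  - exact: continuous_subspaceW cu.
  - by move=> y ky; apply: Jj; exists y.
  - by move=> y /kB /vK.
  - exact: continuous_subspaceW cv.
have fk : (size f <= size k)%N.
  by apply: size_prefix; apply: (core_node_prefix EE_middle dd_E kux); exact: Bf'.
apply: (nE (size h) (size k)).
  by move=> hkE; move: (leq_trans hf fk); rewrite hkE ltnn.
apply: subhomeo_homeomorphic; apply: (subhomeo_trans _ (subhomeo_core k)).
exact: (subhomeo_trans (subhomeo_sym (subhomeo_core h)) hk).
Qed.

Lemma limit_space_no_constant_universal_sequence :
  (forall l m, l <> m -> ~ homeomorphic (E l) (E m)) ->
  ~ constant_universal_sequence X.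
Proof.
move=> nE [T [t _] seqT].
have cX : compact [set: X].
  by apply/compact_set_type; exact: (compact_limit_space EE_middle dd_E EE_compact).
(* a clopen copy of T near x, as a subset of the ambient space *)
have transport (x : R3) (Xx : X x) (U : set R3) : nbhs x U ->
    exists B : set R3, [/\ B `<=` U, clopen_part B & homeomorphic B T].
  move=> xU; have [C [_ clC CT Cx]] := seqT (exist _ x (mem_set Xx)).
  have [n _ CU] : \forall n \near \oo, C n `<=` set_val @^-1` U.
    by apply: Cx; exact: initial_continuous.
  have [[Q oQ QC] cC] := clC n.
  exists (set_val @` C n); split.
  - by move=> _ [y Cy <-]; exact: (CU n (leqnn n)).
  - split=> [_ [y _ <-]||_ [y Cy <-]].
    + exact: set_valP.
    + apply: (compact_closed (@norm_hausdorff _ _)); apply: continuous_compact.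
        by apply: continuous_subspaceT; exact: initial_continuous.
      exact: (subclosed_compact cC cX).
    + have : nbhs (set_val y) Q.
        by apply: open_nbhs_nbhs; split=> //; move: Cy; rewrite -QC.
      apply: filterS => z Qz Xz; exists (exist _ z (mem_set Xz)) => //.
      by rewrite -QC.
  - exact: homeomorphic_trans (homeomorphic_sym (homeomorphic_set_val _)) (CT n).
have [x gx] := branch_point EE_middle dd_E (fun=> 0%N).
have Xx := branch_limit_space gx.
have [B [_ BC BT]] := transport x Xx setT filterT; have [BX _ oB] := BC.
have [y By] : B !=set0.
  by have [_ [v _]] := BT; exists (set_val (v t)); exact: set_valP.
have Xy := BX _ By.
have /nbhs_ballP[e /= e0 eB] := oB _ By.
have [h he _] := limit_space_near EE_middle dd_E EE_connected EE_points
  dd_closure Xy e0.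
have hB : core h `<=` B.
  move=> z hz; apply: (eB z); first exact/he/(core_node EE_middle).
  exact: (core_limit_space EE_middle dd_E hz).
pose f := mkseq (fun=> 0%N) (size h).+1.
have [Q [oQ fQ XQ]] := node_open EE_middle dd_E EE_compact f.
have [B' [BQ' BC' BT']] :=
  transport x Xx Q (open_nbhs_nbhs (conj oQ (fQ _ (gx _)))).
have : (size f <= size h)%N.
  apply: (clopen_part_level nE BC BC' _ hB).
    apply: (homeomorphic_subhomeo x x).
    exact: homeomorphic_trans BT (homeomorphic_sym BT').
  by move=> z Bz; apply: XQ; split; [case: BC' => + _ _; exact|exact: BQ'].
by rewrite size_mkseq ltnn.
Qed.

End self_similarity.

Theorem theorem6p10 (R : realType)
    (E : nat -> set 'rV[R]_3) (d : nat -> nat -> 'rV[R]_3)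
    (E_continuum : forall n, continuum R (E n))
    (E_nontrivial : forall n, nontrivial (E n))
    (E_middle : forall n, E n `<=` @middle_square R)
    (E_not_homeo : forall m n, m <> n -> ~ homeomorphic (E m) (E n))
    (d_dense : forall n, dense_enumeration (E n) (d n)) :
  let X := limit_space (fun f => E (size f)) (fun f => d (size f)) in
  [/\ ~ reconstructible X,
      compact [set: X],
      metrizable R X &
      ~ constant_universal_sequence X].
Proof.
have E_compact n : compact (E n) by apply/compact_set_type; case: (E_continuum n).
have E_connected n : connected (E n).
  by apply: connected_set_type; case: (E_continuum n).
have E_points n : exists x y, [/\ E n x, E n y & x <> y].
  have [x [y xy]] := E_nontrivial n; exists (set_val x), (set_val y).
  by split; [exact: set_valP|exact: set_valP|move=> /val_inj].
have d_E n : range (d n) `<=` E n by case: (d_dense n).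
have d_closure n : E n `<=` closure (range (d n)) by case: (d_dense n).
split.
- exact: limit_space_non_reconstructible.
- by apply/compact_set_type; apply: compact_limit_space => f.
- exact: metrizable_subset.
- exact: limit_space_no_constant_universal_sequence.
Qed.
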